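(* Let $F_{3,2}$ be the $3$-graph on vertex set $\{1,2,3,4,5\}$ with edge set $\{123,145,245,345\}$, and let $\overline{F_{3,2}}$ be its complement. Then $$\pi(F_{3,2},\ \text{induced } \overline{F_{3,2}}) = \frac{3}{8} < \frac{4}{9} = \pi(F_{3,2}).$$
   Context: A $3$-graph is a finite $3$-uniform hypergraph: a finite vertex set together with a set of $3$-element subsets (edges); $xyz$ abbreviates $\{x,y,z\}$. The complement $\overline{F}$ of a $3$-graph $F$ is the $3$-graph on the same vertex set whose edges are exactly the triples that are not edges of $F$. The Turán density $\pi(F)$ is $\lim_{n\to\infty}\operatorname{ex}(n,F)/\binom{n}{3}$, where $\operatorname{ex}(n,F)$ is the maximum number of edges in an $n$-vertex $3$-graph containing no copy of $F$ as a (not necessarily induced) subhypergraph. For $3$-graphs $F$ and $G$, $\pi(F,\ \text{induced } G)$ is $\lim_{n\to\infty} m_n/\binom{n}{3}$, where $m_n$ is the maximum number of edges in an $n$-vertex $3$-graph $H$ such that $H$ contains no (not necessarily induced) copy of $F$ as a subhypergraph and no set of vertices of $H$ induces a subhypergraph isomorphic to $G$ (the subhypergraph induced by $S\subseteq V(H)$ has vertex set $S$ and all edges of $H$ contained in $S$). *)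

(* Defs.v *)
From HB Require Import structures.
From mathcomp Require Import all_boot all_order all_algebra.
From mathcomp Require Import all_classical all_reals all_analysis.
Import Order.TTheory GRing.Theory Num.Theory.
Import numFieldNormedType.Exports.

Set Implicit Arguments.
Unset Strict Implicit.
Unset Printing Implicit Defensive.

Local Open Scope ring_scope.

Definition triples (T : finType) : {set {set T}} := [set e : {set T} | #|e| == 3].

Record tgraph (T : finType) := TGraph {
  edges : {set {set T}};
  edges_triples : edges \subset triples T }.

HB.instance Definition _ (T : finType) := [isSub for @edges T].
HB.instance Definition _ (T : finType) := [Countable of tgraph T by <:].
HB.instance Definition _ (T : finType) := [Finite of tgraph T by <:].

Definition compl_tgraph (T : finType) (F : tgraph T) : tgraph T :=
  TGraph (subsetDl (triples T) (edges F)).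

Definition image_edges (T U : finType) (f : T -> U) (E : {set {set T}}) :
  {set {set U}} := [set f @: (e : {set T}) | e in E].

Definition induced_edges (T : finType) (H : tgraph T) (S : {set T}) :
  {set {set T}} := [set e in edges H | e \subset S].

Definition contains (T U : finType) (F : tgraph T) (H : tgraph U) : bool :=
  [exists f : {ffun T -> U},
    injectiveb f && (image_edges f (edges F) \subset edges H)].

Definition contains_induced (T U : finType) (G : tgraph T) (H : tgraph U) :
    bool :=
  [exists S : {set U}, exists f : {ffun T -> U},
    [&& injectiveb f, f @: [set: T] == S
      & image_edges f (edges G) == induced_edges H S]].

Definition ex_turan (T : finType) (F : tgraph T) (n : nat) : nat :=
  \max_(H : tgraph 'I_n | ~~ contains F H) #|edges H|.

Definition ex_turan_induced (T U : finType) (F : tgraph T) (G : tgraph U)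
    (n : nat) : nat :=
  \max_(H : tgraph 'I_n | ~~ contains F H && ~~ contains_induced G H)
    #|edges H|.

(* The terms with n < 3 are the junk value _ / 0 = 0. *)
Definition edge_density (R : realType) (m : nat -> nat) : R^nat :=
  fun n => (m n)%:R / 'C(n, 3)%:R.

(* [lim] is total; its value is meaningful when the sequence converges. *)
Definition turan_density (R : realType) (T : finType) (F : tgraph T) : R :=
  limn (edge_density R (ex_turan F)).

Definition turan_density_induced (R : realType) (T U : finType)
    (F : tgraph T) (G : tgraph U) : R :=
  limn (edge_density R (ex_turan_induced F G)).

(* Vertices are numbered from 0, so the vertex i of 'I_5 stands for i + 1. *)
Definition triple5 (i j k : nat) : {set 'I_5} :=
  [set inord i; inord j; inord k].

Definition F32_edges : {set {set 'I_5}} :=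
  [set triple5 0 1 2; triple5 0 3 4; triple5 1 3 4; triple5 2 3 4].

Lemma card_triple5 (i j k : nat) :
  (i < j < k)%N -> (k < 5)%N -> #|triple5 i j k| = 3%N.
Proof.
move=> /andP[ij jk] k5; have j5 := ltn_trans jk k5; have i5 := ltn_trans ij j5.
rewrite /triple5 -finset.setUA cardsU1 cards2 !inE -!val_eqE /= !inordK //.
by rewrite (ltn_eqF ij) (ltn_eqF jk) (ltn_eqF (ltn_trans ij jk)).
Qed.

Lemma F32_edges_triples : F32_edges \subset triples 'I_5.
Proof.
apply/fintype.subsetP => e; rewrite !inE -!orbA.
by case/or4P => /eqP ->; rewrite card_triple5.
Qed.

Definition F32 : tgraph 'I_5 := TGraph F32_edges_triples.

(* Main.v *)
From Stdlib Require Import ZArith.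
Require Import Defs.
From mathcomp Require Import all_boot all_order all_algebra.
From mathcomp Require Import ssrZ zify lra.
From mathcomp Require Import all_classical all_reals all_analysis.
Import Order.TTheory GRing.Theory Num.Theory.
Import numFieldNormedType.Exports.

(** Both densities are squeezed between a construction and an upper bound of
    the form 6 |E| <= c n^3 + O(n^2); [edge_density_cvg] turns such a squeeze
    into a limit.

    Lower bounds. Split the vertices as A + B with |B| about n/3 and take the
    triples with exactly one vertex in B ([two_plus_one]): this is F32-free of
    density 4/9. The complete balanced 4-partite 3-graph ([four_partite]) is
    F32-free of density 3/8. It has no induced copy of the complement of F32
    either: there 013, 023 and 123 are edges but 012 is not, whereas in a
    4-partite 3-graph the three edges put 0, 1 and 2 into different parts, so
    that 012 is an edge as well.

    Upper bounds. Any two vertices of F32 lie in a common edge, so blowing up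
    the vertices of an F32-free 3-graph creates no copy of F32. Hence one may
    sum over all 6-tuples of vertices, repetitions allowed, and get inequalities
    without error terms. The argument is a sum-of-squares one in the style of
    flag algebras. From c0 - c1 e(x0,x1,x2), where e is the adjacency relation,
    subtract two kinds of weighted products, whose sums over all tuples are sums
    of squares: g(x0,x1;x2,x3) g(x0,x1;x4,x5), and, when (x0,x1,x2,x3) spans a
    prescribed pattern, h(x0,..,x3;x4) h(x0,..,x3;x5) ([sum_squares_ge0]). If
    the remaining [score] is nonnegative on average over the 720 relabellings of
    every F32-free 3-graph on six vertices, then c1 e has mean at most c0
    ([score_count]). That is a finite verification, [F32_certificate_verified],
    and it gives 9 * 6 |E| <= 4 n^3 ([F32_free_count]).

    For the second density, let K4m be the 3-graph with three edges on four
    vertices; its apex is the common vertex of the edges and its base the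
    remaining triple. If one triple is the base of two induced copies of K4m
    with different apexes in an F32-free 3-graph, these five vertices induce
    the complement of F32 ([contains_induced_coF32]). So there are at most n^3
    such copies, which is negligible among n^4 quadruples, and the finite
    verification need only deal with six-vertex patterns that contain neither
    F32 nor an induced K4m ([K4m_certificate_verified], [F32_K4m_count]).

    The verification is made small by symmetry: it suffices to treat one pattern
    per isomorphism class, and [exists_maximal] provides representatives that
    maximise a numerical [code]. *)

Set Implicit Arguments.
Unset Strict Implicit.
Unset Printing Implicit Defensive.

(* The usual key %Z is bound to the scope of the ring [int]. *)
Delimit Scope Z_scope with BinZ.

(** * Sum-of-squares certificates *)

Definition hyperrel (T : Type) := T -> T -> T -> bool.

Definition bitZ (b : bool) : Z := if b then 1%BinZ else 0%BinZ.

(** A certificate for the inequality [scale * density <= target]. Each entry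
    of [pair_squares] is a weight and a form in the adjacencies of abu, abv,
    auv, buv, to be summed over u, v and squared, for every pair a, b. Each
    entry of [quad_squares] is a weight and a form in the adjacencies of abu,
    acu, adu, bcu, bdu, cdu, to be summed over u and squared, for every
    quadruple whose adjacencies abc, abd, acd, bcd satisfy [quad_root]. *)
Record certificate := Certificate {
  target : Z;
  scale : Z;
  pair_squares : seq (Z * (Z -> Z -> Z -> Z -> Z));
  quad_root : bool -> bool -> bool -> bool -> bool;
  quad_squares : seq (Z * (Z -> Z -> Z -> Z -> Z -> Z -> Z)) }.

(** Unlike a big operator, this sum computes. *)
Fixpoint sumZ (T : Type) (F : T -> Z) (s : seq T) : Z :=
  if s is t :: s' then (F t + sumZ F s')%BinZ else 0%BinZ.

Lemma sumZE T (F : T -> Z) s : sumZ F s = (\sum_(t <- s) F t)%R.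
Proof. by elim: s => [|t s IHs]; rewrite ?big_nil // big_cons /= IHs. Qed.

Definition pair_sum (C : certificate) (s t d1 d2 s' t' d1' d2' : Z) : Z :=
  sumZ (fun g => g.1 * (g.2 s t d1 d2 * g.2 s' t' d1' d2'))%BinZ (pair_squares C).

Definition pair_form (C : certificate) (T : Type) (e : hyperrel T)
    (a b u v u' v' : T) : Z :=
  pair_sum C (bitZ (e a b u)) (bitZ (e a b v)) (bitZ (e a u v)) (bitZ (e b u v))
    (bitZ (e a b u')) (bitZ (e a b v')) (bitZ (e a u' v')) (bitZ (e b u' v')).

Definition quad_sum (C : certificate)
    (x12 x13 x14 x23 x24 x34 y12 y13 y14 y23 y24 y34 : Z) : Z :=
  sumZ (fun g => g.1 * (g.2 x12 x13 x14 x23 x24 x34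
                        * g.2 y12 y13 y14 y23 y24 y34))%BinZ (quad_squares C).

Definition quad_form (C : certificate) (T : Type) (e : hyperrel T)
    (a b c d u v : T) : Z :=
  if quad_root C (e a b c) (e a b d) (e a c d) (e b c d) then
    quad_sum C
      (bitZ (e a b u)) (bitZ (e a c u)) (bitZ (e a d u))
      (bitZ (e b c u)) (bitZ (e b d u)) (bitZ (e c d u))
      (bitZ (e a b v)) (bitZ (e a c v)) (bitZ (e a d v))
      (bitZ (e b c v)) (bitZ (e b d v)) (bitZ (e c d v))
  else 0%BinZ.

Definition score (C : certificate) (T : Type) (e : hyperrel T)
    (a b c d u v : T) : Z :=
  (target C - scale C * bitZ (e a b c) - pair_form C e a b c d u v
    - quad_form C e a b c d u v)%BinZ.

(** * Sums over 6-tuples *)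

Section Sum.
Variables (V : finType).

Lemma big_ffun6 (F : V -> V -> V -> V -> V -> V -> Z) :
  (\sum_(x : {ffun 'I_6 -> V})
     F (x (inord 0)) (x (inord 1)) (x (inord 2))
       (x (inord 3)) (x (inord 4)) (x (inord 5)) =
  \sum_(a : V) \sum_(b : V) \sum_(c : V) \sum_(d : V) \sum_(u : V) \sum_(v : V)
     F a b c d u v)%R.
Proof.
pose G (y : V * (V * (V * (V * (V * V))))) :=
  let: (a, (b, (c, (d, (u, v))))) := y in F a b c d u v.
transitivity (\sum_y G y)%R; last first.
  have split_sum (A B : finType) (H : A * B -> Z) :
      (\sum_y H y = \sum_a \sum_b H (a, b))%R.
    by rewrite pair_bigA; apply: eq_bigr; case.
  rewrite split_sum; apply: eq_bigr => a _.
  rewrite split_sum; apply: eq_bigr => b _.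
  rewrite split_sum; apply: eq_bigr => c _.
  rewrite split_sum; apply: eq_bigr => d _.
  by rewrite split_sum.
pose tup (x : {ffun 'I_6 -> V}) :=
  (x (inord 0), (x (inord 1), (x (inord 2), (x (inord 3),
    (x (inord 4), x (inord 5)))))).
pose fun6 (y : V * (V * (V * (V * (V * V))))) : {ffun 'I_6 -> V} :=
  let: (a, (b, (c, (d, (u, v))))) := y in
  [ffun i : 'I_6 => nth a [:: a; b; c; d; u; v] i].
rewrite (reindex tup) //=; exists fun6 => [x _|y _].
  apply/ffunP => i; rewrite /fun6 /tup ffunE.
  have -> : i = inord i by rewrite inord_val.
  by case: i => -[|[|[|[|[|[|]]]]]] //= ltk; rewrite inordK.
by case: y => a [b [c [d [u v]]]]; rewrite /tup /fun6 !ffunE !inordK.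
Qed.

End Sum.

(** * Relabelling six-vertex patterns *)

(** Relabellings are lists, so that sums over them can be evaluated. *)
Definition S6 : seq (seq nat) := permutations (iota 0 6).

Arguments S6 : simpl never.

(** A pattern is a relation on naturals that vanishes beyond 5. The default
    value 6 makes [act p] preserve this. *)
Definition act (p : seq nat) (f : hyperrel nat) : hyperrel nat :=
  fun i j k => f (nth 6 p i) (nth 6 p j) (nth 6 p k).

Definition compose (q p : seq nat) : seq nat := [seq nth 6 q i | i <- p].

Definition orb (h : hyperrel nat -> Z) (f : hyperrel nat) : Z :=
  (\sum_(p <- S6) h (act p f))%R.

Lemma mem_S6 p : (p \in S6) = perm_eq p (iota 0 6).
Proof. exact: mem_permutations. Qed.

Lemma size_S6 p : p \in S6 -> size p = 6.
Proof. by rewrite mem_S6 => /perm_size. Qed.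

Lemma nth_S6_lt p i : p \in S6 -> (nth 6 p i < 6)%N = (i < 6)%N.
Proof.
move=> p6; have [i6|i6] := ltnP i 6; last by rewrite nth_default ?size_S6.
have /(mem_nth 6) : (i < size p)%N by rewrite size_S6.
by move: p6; rewrite mem_S6 => /perm_mem ->; rewrite mem_iota.
Qed.

Lemma act_compose q p f : q \in S6 -> act p (act q f) = act (compose q p) f.
Proof.
move=> q6; have nth_compose i : nth 6 (compose q p) i = nth 6 q (nth 6 p i).
  have [ip|ip] := ltnP i (size p); first by rewrite (nth_map 6).
  by rewrite !nth_default ?size_map // size_S6.
by rewrite /act; apply/funext=> i; apply/funext=> j; apply/funext=> k;
  rewrite !nth_compose.
Qed.

Lemma compose_S6 q p : q \in S6 -> p \in S6 -> compose q p \in S6.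
Proof.
move=> q6; rewrite !mem_S6 => /(perm_map (nth 6 q)) /perm_trans -> //.
have -> : map (nth 6 q) (iota 0 6) = q.
  by have := mkseq_nth 6 q; rewrite (size_S6 q6).
by rewrite -mem_S6.
Qed.

Lemma compose_perm q : q \in S6 -> perm_eq (map (compose q) S6) S6.
Proof.
move=> q6.
have compose_inj : {in S6 &, injective (compose q)}.
  move=> p p' p6 p'6; apply: (@inj_in_map _ _ (nth 6 q) [in iota 0 6]).
  - move=> i j; rewrite !mem_iota /= => i6 j6 /eqP.
    rewrite nth_uniq ?size_S6 // => [/eqP //|].
    by move: q6; rewrite mem_S6 => /perm_uniq ->.
  - rewrite inE; apply/allP => i.
    by move: p6; rewrite mem_S6 => /perm_mem ->.
  - rewrite inE; apply/allP => i.
    by move: p'6; rewrite mem_S6 => /perm_mem ->.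
have compose_uniq : uniq (map (compose q) S6).
  by rewrite map_inj_in_uniq ?permutations_uniq.
apply: (uniq_perm compose_uniq (permutations_uniq _)).
apply: (uniq_min_size compose_uniq _ _).2; last by rewrite size_map.
by move=> _ /mapP[p p6 ->]; apply: compose_S6.
Qed.

Lemma orb_act q h f : q \in S6 -> orb h (act q f) = orb h f.
Proof.
move=> q6; rewrite /orb -[RHS](perm_big _ (compose_perm q6)) big_map.
by apply: eq_bigr => p _; rewrite act_compose.
Qed.

(** Sums over an orbit are evaluated on coset representatives [L] of a group
    [K] of symmetries of [h]. *)
Lemma orb_transversal (h : hyperrel nat -> Z) (L K : seq (seq nat)) f :
  perm_eq [seq compose t k | t <- L, k <- K] S6 -> {subset L <= S6} ->
  (forall t k, t \in L -> k \in K -> h (act k (act t f)) = h (act t f)) ->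
  orb h f = (\sum_(t <- L) h (act t f) *+ size K)%R.
Proof.
move=> LK6 L6 hK; rewrite /orb -(perm_big _ LK6) big_allpairs_dep.
rewrite !big_seq; apply: eq_bigr => t tL.
rewrite -iter_addr_0 -[size K]count_predT -big_const_seq !big_seq.
by apply: eq_bigr => k kK; rewrite -act_compose ?L6 // hK.
Qed.

(** * 3-graphs as ternary relations *)

Definition hypergraph (T : Type) (e : hyperrel T) : Prop :=
  [/\ forall x y z, e x y z = e y x z, forall x y z, e x y z = e x z y
    & forall x y, e x x y = false].

Definition supported (f : hyperrel nat) : Prop :=
  forall i j k, f i j k -> [&& (i < 6)%N, (j < 6)%N & (k < 6)%N].

Lemma hypergraph_act f p : hypergraph f -> hypergraph (act p f).
Proof. by case=> f12 f23 f11; split=> *; rewrite /act ?f11 //. Qed.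

Lemma supported_act f p : p \in S6 -> supported f -> supported (act p f).
Proof. by move=> p6 f6 i j k /f6; rewrite !nth_S6_lt. Qed.

(** * Encoding six-vertex patterns by bits *)

(** The triples i < j < k of vertices in colexicographic order: those inside
    the first five vertices come first. *)
Definition triples6 : seq (nat * nat * nat) :=
  Eval vm_compute in
  [seq (s.2, s.1.2, s.1.1) |
    s <- [seq (kj, i) | kj <- [seq (k, j) | k <- iota 0 6, j <- iota 0 k],
                        i <- iota 0 kj.2]].

Definition sort3 (i j k : nat) : nat * nat * nat :=
  if (i <= j)%N then
    if (j <= k)%N then (i, j, k) else if (i <= k)%N then (i, k, j) else (k, i, j)
  else if (i <= k)%N then (j, i, k)
    else if (j <= k)%N then (j, k, i) else (k, j, i).

Definition at3 (f : hyperrel nat) (t : nat * nat * nat) : bool :=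
  let: (i, j, k) := t in f i j k.

(** Degenerate triples get the slot 20, beyond the end of a list of 20 bits. *)
Definition slot_table : seq (seq (seq nat)) :=
  Eval vm_compute in
  [seq [seq [seq index (sort3 i j k) triples6
    | k <- iota 0 6] | j <- iota 0 6] | i <- iota 0 6].

Definition slot (i j k : nat) : nat :=
  nth 20 (nth [::] (nth [::] slot_table i) j) k.

Definition of_bits (b : seq bool) : hyperrel nat :=
  fun i j k => nth false b (slot i j k).

Definition to_bits (f : hyperrel nat) : seq bool :=
  map (at3 f) triples6.

Lemma slot_in i j k : (i < 6)%N -> (j < 6)%N -> (k < 6)%N ->
  slot i j k = index (sort3 i j k) triples6 /\
  (sort3 i j k \in triples6) || [|| i == j, j == k | i == k].
Proof.
move=> i6 j6 k6; pose ok i j k := (slot i j k == index (sort3 i j k) triples6) &&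
  ((sort3 i j k \in triples6) || [|| i == j, j == k | i == k]).
have all_ok : all (fun i => all (fun j => all (ok i j) (iota 0 6)) (iota 0 6))
    (iota 0 6) by vm_compute.
have in6 m : (m < 6)%N -> m \in iota 0 6 by rewrite mem_iota.
move: all_ok => /allP/(_ _ (in6 _ i6)) /allP/(_ _ (in6 _ j6)).
by move=> /allP/(_ _ (in6 _ k6)) /andP[/eqP].
Qed.

Lemma slot_out i j k :
  ~~ [&& (i < 6)%N, (j < 6)%N & (k < 6)%N] -> slot i j k = 20.
Proof.
have rows : all (fun r => (size r == 6) && all (fun c => size c == 6) r) slot_table.
  by [].
rewrite /slot !negb_and -!leqNgt.
have [i6 _|i6] := leqP 6 i; first by rewrite (@nth_default _ [::] slot_table) ?nth_nil.
have /andP[/eqP row /allP cols] := all_nthP [::] rows i i6.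
have [j6 _|j6] /= := leqP 6 j; first by rewrite (nth_default [::]) ?row ?nth_nil.
move=> k6; rewrite nth_default //.
by have /eqP -> := cols _ (mem_nth [::] (etrans (congr1 _ row) j6)).
Qed.

Lemma to_bitsK f : hypergraph f -> supported f -> of_bits (to_bits f) = f.
Proof.
move=> [f12 f23 f11] f6; apply/funext=> i; apply/funext=> j; apply/funext=> k.
have f13 x y z : f x y z = f z y x by rewrite f12 f23 f12.
have fsort : f i j k = at3 f (sort3 i j k).
  rewrite /sort3; case: ifP => _; case: ifP => _; try case: ifP => _;
    rewrite //=; first [exact: f12 | exact: f23 | exact: f13
      | by rewrite f12 f23 | by rewrite f23 f12].
case: (boolP [&& (i < 6)%N, (j < 6)%N & (k < 6)%N]) => [|out]; last first.
  rewrite /of_bits slot_out // nth_default //.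
  by apply/esym/negbTE; apply: contra out => /f6.
case/and3P=> i6 j6 k6; have [slotE] := slot_in i6 j6 k6.
rewrite /of_bits slotE fsort; case: (boolP (_ \in _)) => [sT _|sT].
  by rewrite (nth_map (0, 0, 0)%N) ?index_mem ?nth_index.
rewrite nth_default => [|]; last by rewrite size_map leqNgt index_mem.
rewrite -fsort /= => /or3P[]/eqP ->; first by rewrite f11.
  by rewrite f13 f11.
by rewrite f23 f11.
Qed.

(** * Patterns of maximal code *)

(** The weights 1024 + 2^i make the code injective on the patterns of the first
    five vertices and monotone in their number of edges, so that in a pattern of
    maximal code the last vertex has minimum degree. *)
Definition triples5 : seq (Z * (nat * nat * nat)) :=
  Eval vm_compute in
  [seq ((1024 + 2 ^ Z.of_nat i)%BinZ, nth (0, 0, 0)%N triples6 i) | i <- iota 0 10].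

Definition code (f : hyperrel nat) : Z :=
  sumZ (fun w => let: (c, t) := w in if at3 f t then c else 0%BinZ) triples5.

(** A conjunction that stops at the first failure even when evaluated call by
    value. *)
Fixpoint alls (T : Type) (a : T -> bool) (s : seq T) : bool :=
  if s is x :: s' then if a x then alls a s' else false else true.

Lemma allsE T (a : T -> bool) s : alls a s = all a s.
Proof. by elim: s => //= x s ->; case: (a x). Qed.

Definition maximal (L : seq (seq nat)) (f : hyperrel nat) : bool :=
  let c := code f in alls (fun p => Z.leb (code (act p f)) c) L.

Lemma exists_max (T : eqType) (F : T -> Z) (s : seq T) : s != [::] ->
  exists2 q, q \in s & forall p, p \in s -> (F p <= F q)%BinZ.
Proof.
elim: s => [//|x [|y s] IHs] _.
  by exists x => [|p]; rewrite mem_seq1 // => /eqP ->; apply: Z.le_refl.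
have [//|q qs qmax] := IHs.
have [le_qx|lt_xq] := Z.le_gt_cases (F q) (F x).
  exists x => [|p]; first exact: mem_head.
  rewrite inE => /predU1P[->|/qmax le_pq]; first exact: Z.le_refl.
  exact: Z.le_trans le_qx.
exists q => [|p]; first by rewrite inE qs orbT.
rewrite inE => /predU1P[->|/qmax //]; exact: Z.lt_le_incl.
Qed.

(** Symmetry breaking: every pattern can be relabelled so as to pass each test
    [maximal L]. *)
Lemma exists_maximal f :
  exists2 q, q \in S6 & forall L, {subset L <= S6} -> maximal L (act q f).
Proof.
have [|q q6 qmax] := @exists_max _ (fun p => code (act p f)) S6.
  by have : iota 0 6 \in S6 by rewrite mem_S6.
exists q => // L L6; rewrite /maximal allsE; apply/allP => p /L6 p6.
by rewrite act_compose //; apply/Z.leb_le/qmax/compose_S6.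
Qed.

Fixpoint bit_lists (n : nat) : seq (seq bool) :=
  if n is n'.+1 then
    [seq false :: b | b <- bit_lists n'] ++ [seq true :: b | b <- bit_lists n']
  else [:: [::]].

Lemma mem_bit_lists b : b \in bit_lists (size b).
Proof.
elim: b => [//|[] b IHb] /=; rewrite mem_cat; apply/orP; [right|left];
  by apply/mapP; exists b.
Qed.

Definition S5 : seq (seq nat) :=
  Eval vm_compute in [seq rcons p 5 | p <- permutations (iota 0 5)].

Definition last_swaps : seq (seq nat) :=
  Eval vm_compute in
  [seq [seq (if j == i then 5 else if j == 5 then i else j)
    | j <- iota 0 6] | i <- iota 0 5].

Lemma S5_sub : {subset S5 <= S6}.
Proof. by apply/allP; vm_compute. Qed.

Lemma last_swaps_sub : {subset last_swaps <= S6}.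
Proof. by apply/allP; vm_compute. Qed.

(** The code and its maximality under [S5] only involve the first five
    vertices, that is the first ten bits: sparse and redundant beginnings can be
    discarded before the last ten bits are enumerated. *)
Lemma maximal_take b : maximal S5 (of_bits b) -> maximal S5 (of_bits (take 10 b)).
Proof.
have slots : alls (fun p => alls (fun w => let: (i, j, k) := w.2 in
    (slot (nth 6 p i) (nth 6 p j) (nth 6 p k) < 10)%N) triples5) (iota 0 6 :: S5).
  by vm_compute.
have codeE p : p \in iota 0 6 :: S5 ->
    code (act p (of_bits (take 10 b))) = code (act p (of_bits b)).
  move=> pS; rewrite /code !sumZE; apply: eq_big_seq => -[c [[i j] k]] tT.
  move: slots; rewrite allsE => /allP/(_ _ pS); rewrite allsE => /allP/(_ _ tT).
  by move=> lt10; rewrite /at3 /act /of_bits nth_take.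
have code_id f : code f = code (act (iota 0 6) f) by [].
rewrite /maximal !allsE => /allP max_b; apply/allP => p pS.
have p_in : p \in iota 0 6 :: S5 by rewrite inE pS orbT.
rewrite [code (of_bits (take _ _))]code_id (codeE _ p_in) codeE ?mem_head //.
by rewrite -code_id max_b.
Qed.

(** * Symmetries of the score *)

Definition increasing (p : seq nat) (i j : nat) : bool :=
  (nth 6 p i < nth 6 p j)%N.

Definition edge_cosets : seq (seq nat) :=
  Eval vm_compute in
  [seq p <- S6 | [&& increasing p 0 1, increasing p 1 2, increasing p 3 4
                   & increasing p 4 5]].

Definition pair_cosets : seq (seq nat) :=
  Eval vm_compute in
  [seq p <- S6 | [&& increasing p 0 1, increasing p 2 3, increasing p 4 5
                   & increasing p 2 4]].

Definition quad_cosets : seq (seq nat) :=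
  Eval vm_compute in
  [seq p <- S6 | [&& increasing p 0 1, increasing p 2 3 & increasing p 4 5]].

Definition edge_stabiliser : seq (seq nat) :=
  Eval vm_compute in
  [seq s ++ t | s <- permutations (iota 0 3), t <- permutations (iota 3 3)].

Definition pair_stabiliser : seq (seq nat) :=
  Eval vm_compute in
  [seq s ++ t | s <- permutations (iota 0 2),
     t <- [seq u ++ v | u <- permutations [:: 2; 3], v <- permutations [:: 4; 5]]
       ++ [seq u ++ v | u <- permutations [:: 4; 5], v <- permutations [:: 2; 3]]].

Definition quad_stabiliser : seq (seq nat) :=
  Eval vm_compute in
  [seq s ++ t | s <- permutations (iota 0 2),
     t <- [seq u ++ v | u <- permutations [:: 2; 3], v <- permutations [:: 4; 5]]].

Fixpoint lex_leq (p q : seq nat) : bool :=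
  match p, q with
  | i :: p', j :: q' => if (i < j)%N then true else if i == j then lex_leq p' q' else false
  | [::], _ => true
  | _, [::] => false
  end.

(** Sorting decides [perm_eq] on lists of 720 relabellings in quasilinear
    time. *)
Lemma perm_eq_sort (s t : seq (seq nat)) :
  sort lex_leq s = sort lex_leq t -> perm_eq s t.
Proof. by move=> st; rewrite -(perm_sort lex_leq s) st perm_sort. Qed.

Lemma edge_transversal :
  perm_eq [seq compose t k | t <- edge_cosets, k <- edge_stabiliser] S6.
Proof. by apply: perm_eq_sort; vm_compute. Qed.

Lemma pair_transversal :
  perm_eq [seq compose t k | t <- pair_cosets, k <- pair_stabiliser] S6.
Proof. by apply: perm_eq_sort; vm_compute. Qed.

Lemma quad_transversal :
  perm_eq [seq compose t k | t <- quad_cosets, k <- quad_stabiliser] S6.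
Proof. by apply: perm_eq_sort; vm_compute. Qed.

Lemma edge_cosets_sub : {subset edge_cosets <= S6}.
Proof. by apply/allP; vm_compute. Qed.

Lemma pair_cosets_sub : {subset pair_cosets <= S6}.
Proof. by apply/allP; vm_compute. Qed.

Lemma quad_cosets_sub : {subset quad_cosets <= S6}.
Proof. by apply/allP; vm_compute. Qed.

(** The symmetries hold as soon as each form is at most changed in sign when
    the roots a and b, the roots c and d, or the vertices u and v of a pair
    extension are swapped, because it enters through products of two values. *)
Record valid_certificate (C : certificate) : Prop := ValidCertificate {
  pair_weights_ge0 : all (fun g => Z.leb 0 g.1) (pair_squares C);
  quad_weights_ge0 : all (fun g => Z.leb 0 g.1) (quad_squares C);
  pair_sum_roots : forall s t d1 d2 s' t' d1' d2',
    pair_sum C s t d2 d1 s' t' d2' d1' = pair_sum C s t d1 d2 s' t' d1' d2';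
  pair_sum_ext : forall s t d1 d2 s' t' d1' d2',
    pair_sum C t s d1 d2 s' t' d1' d2' = pair_sum C s t d1 d2 s' t' d1' d2';
  quad_root12 : forall x y z w, quad_root C x y w z = quad_root C x y z w;
  quad_root34 : forall x y z w, quad_root C y x z w = quad_root C x y z w;
  quad_sum12 : forall x01 x02 x03 x12 x13 x23 y01 y02 y03 y12 y13 y23,
    quad_sum C x01 x12 x13 x02 x03 x23 y01 y12 y13 y02 y03 y23 =
    quad_sum C x01 x02 x03 x12 x13 x23 y01 y02 y03 y12 y13 y23;
  quad_sum34 : forall x01 x02 x03 x12 x13 x23 y01 y02 y03 y12 y13 y23,
    quad_sum C x01 x03 x02 x13 x12 x23 y01 y03 y02 y13 y12 y23 =
    quad_sum C x01 x02 x03 x12 x13 x23 y01 y02 y03 y12 y13 y23 }.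

Section Invariance.
Variables (C : certificate) (validC : valid_certificate C).
Variables (T : Type) (e : hyperrel T) (hyper_e : hypergraph e).

Lemma pair_form_roots a b u v u' v' :
  pair_form C e b a u v u' v' = pair_form C e a b u v u' v'.
Proof.
have [e12 _ _] := hyper_e; rewrite /pair_form.
by rewrite !(e12 b a) (pair_sum_roots validC).
Qed.

Lemma pair_form_ext a b u v u' v' :
  pair_form C e a b v u u' v' = pair_form C e a b u v u' v'.
Proof.
have [_ e23 _] := hyper_e; rewrite /pair_form.
by rewrite (e23 a v u) (e23 b v u) (pair_sum_ext validC).
Qed.

Lemma pair_form_swap a b u v u' v' :
  pair_form C e a b u' v' u v = pair_form C e a b u v u' v'.
Proof.
rewrite /pair_form /pair_sum !sumZE; apply: eq_bigr => g _.
by congr (_ * _)%BinZ; apply: Z.mul_comm.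
Qed.

Lemma quad_form12 a b c d u v : quad_form C e b a c d u v = quad_form C e a b c d u v.
Proof.
have [e12 _ _] := hyper_e; rewrite /quad_form !(e12 b a) quad_root12 //.
by case: ifP => // _; exact: quad_sum12.
Qed.

Lemma quad_form34 a b c d u v : quad_form C e a b d c u v = quad_form C e a b c d u v.
Proof.
have [e12 e23 _] := hyper_e; rewrite /quad_form.
rewrite (e23 a d c) (e23 b d c) !(e12 d c) quad_root34 //.
by case: ifP => // _; exact: quad_sum34.
Qed.

Lemma quad_form_swap a b c d u v : quad_form C e a b c d v u = quad_form C e a b c d u v.
Proof.
rewrite /quad_form; case: ifP => // _; rewrite /quad_sum !sumZE; apply: eq_bigr => g _.
by congr (_ * _)%BinZ; apply: Z.mul_comm.
Qed.
End Invariance.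

Definition local_score (C : certificate) (f : hyperrel nat) : Z := score C f 0 1 2 3 4 5.

Definition at6 (R : Type) (h : nat -> nat -> nat -> nat -> nat -> nat -> R)
    (p : seq nat) : R :=
  h (nth 6 p 0) (nth 6 p 1) (nth 6 p 2) (nth 6 p 3) (nth 6 p 4) (nth 6 p 5).

(** The sum of [local_score] over all relabellings, regrouped by cosets. *)
Definition total_score (C : certificate) (f : hyperrel nat) : Z :=
  (720 * target C
    - 36 * scale C * sumZ (at6 (fun a b c _ _ _ => bitZ (f a b c))) edge_cosets
    - 16 * sumZ (at6 (pair_form C f)) pair_cosets
    - 8 * sumZ (at6 (quad_form C f)) quad_cosets)%BinZ.

Lemma orb_edge f : hypergraph f ->
  orb (fun f => bitZ (f 0 1 2)) f =
    (sumZ (at6 (fun a b c _ _ _ => bitZ (f a b c))) edge_cosets *+ 36)%R.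
Proof.
move=> hyp_f; rewrite (orb_transversal edge_transversal edge_cosets_sub).
  by rewrite sumrMnl sumZE.
move=> t k _; have [g12 g23 _] := hypergraph_act t hyp_f.
move: (act t f) g12 g23 => g g12 g23.
have g13 x y z : g x y z = g z y x by rewrite g12 g23 g12.
rewrite !inE; do ?[case/orP=> [/eqP ->|]]; last (move/eqP=> ->);
  congr bitZ; rewrite /act //=; first [exact: g12 | exact: g23 | exact: g13
      | by rewrite g12 g23 | by rewrite g23 g12].
Qed.

Lemma orb_pair C f : valid_certificate C -> hypergraph f ->
  orb (fun f => pair_form C f 0 1 2 3 4 5) f =
    (sumZ (at6 (pair_form C f)) pair_cosets *+ 16)%R.
Proof.
move=> validC hyp_f; rewrite (orb_transversal pair_transversal pair_cosets_sub).
  by rewrite sumrMnl sumZE.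
move=> t k _; have := hypergraph_act t hyp_f; move: (act t f) => g hyp_g.
have rr a b u v u' v' := pair_form_roots validC hyp_g a b u v u' v'.
have ee a b u v u' v' := pair_form_ext validC hyp_g a b u v u' v'.
have ss a b u v u' v' := pair_form_swap C g a b u v u' v'.
have ee' a b u v u' v' : pair_form C g a b u v v' u' = pair_form C g a b u v u' v'.
  by rewrite ss ee ss.
rewrite !inE; do ?[case/orP=> [/eqP ->|]]; last (move/eqP=> ->);
  rewrite -[LHS]/(at6 (pair_form C g) _) /at6 /=;
  by rewrite ?(rr 0 1)%N ?(ee _ _ 2 3)%N ?(ee _ _ 4 5)%N
    ?(ee' _ _ _ _ 2 3)%N ?(ee' _ _ _ _ 4 5)%N ?(ss _ _ 2 3 4 5)%N.
Qed.

Lemma orb_quad C f : valid_certificate C -> hypergraph f ->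
  orb (fun f => quad_form C f 0 1 2 3 4 5) f =
    (sumZ (at6 (quad_form C f)) quad_cosets *+ 8)%R.
Proof.
move=> validC hyp_f; rewrite (orb_transversal quad_transversal quad_cosets_sub).
  by rewrite sumrMnl sumZE.
move=> t k _; have := hypergraph_act t hyp_f; move: (act t f) => g hyp_g.
have h12 a b c d u v := quad_form12 validC hyp_g a b c d u v.
have h34 a b c d u v := quad_form34 validC hyp_g a b c d u v.
have h56 a b c d u v := quad_form_swap C g a b c d u v.
rewrite !inE; do ?[case/orP=> [/eqP ->|]]; last (move/eqP=> ->);
  rewrite -[LHS]/(at6 (quad_form C g) _) /at6 /=;
  by rewrite ?(h12 0 1)%N ?(h34 _ _ 2 3)%N ?(h56 _ _ _ _ 4 5)%N.
Qed.

Lemma orb_score C f : valid_certificate C -> hypergraph f ->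
  orb (local_score C) f = total_score C f.
Proof.
move=> validC hyp_f.
transitivity (\sum_(p <- S6) (target C
   - scale C * bitZ (act p f 0 1 2)%N - pair_form C (act p f) 0%N 1%N 2%N 3%N 4%N 5%N
   - quad_form C (act p f) 0%N 1%N 2%N 3%N 4%N 5%N))%R; first by [].
rewrite !sumrB -mulr_sumr big_const_seq count_predT iter_addr_0.
rewrite [X in (scale C * X)%R](orb_edge hyp_f) [X in (_ - X - _)%R](orb_pair validC hyp_f).
rewrite [X in (_ - X)%R](orb_quad validC hyp_f).
have -> : size S6 = 720 by rewrite size_permutations ?iota_uniq.
rewrite /total_score.
move: (target C) (sumZ _ edge_cosets) (sumZ _ pair_cosets) (sumZ _ quad_cosets).
move=> b x y z; lia.
Qed.

(** * Verification over all patterns *)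

Definition admissible (bad : hyperrel nat -> bool) (L : seq (seq nat))
    (f : hyperrel nat) : bool := alls (fun p => ~~ bad (act p f)) L.

(** The enumeration has two levels, ten bits for the first five vertices and
    ten for the link of the last one. The cheapest tests come first. *)
Definition verify (bad : hyperrel nat -> bool) (L : seq (seq nat))
    (C : certificate) : bool :=
  alls (fun r => if maximal S5 (of_bits r) then
    alls (fun l => let f := of_bits (r ++ l) in
      if maximal last_swaps f then
        if admissible bad L f then Z.leb 0 (total_score C f) else true
      else true) (bit_lists 10) else true) (bit_lists 10).

Lemma orb_score_ge0 bad L C f :
    valid_certificate C -> {subset L <= S6} -> verify bad L C ->
    hypergraph f -> supported f -> {in S6, forall p, ~~ bad (act p f)} ->
  (0 <= orb (local_score C) f)%R.
Proof.
move=> validC L6 checked hyp_f sup_f free_f.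
have [q q6 qmax] := exists_maximal f.
rewrite -(orb_act _ _ q6) orb_score //; last exact: hypergraph_act.
have := to_bitsK (hypergraph_act q hyp_f) (supported_act q6 sup_f).
set b := to_bits _ => bE.
have b20 : size b = 20 by rewrite size_map.
have split_b : take 10 b ++ drop 10 b = b := cat_take_drop 10 b.
move: checked; rewrite /verify allsE => /allP/(_ (take 10 b)).
have -> : take 10 b \in bit_lists 10.
  by have := mem_bit_lists (take 10 b); rewrite size_take b20.
rewrite maximal_take ?bE; last by rewrite -bE bE; apply/qmax/S5_sub.
rewrite allsE => /(_ isT)/allP/(_ (drop 10 b)).
have -> : drop 10 b \in bit_lists 10.
  by have := mem_bit_lists (drop 10 b); rewrite size_drop b20.
rewrite split_b bE qmax; last exact: last_swaps_sub.
rewrite /admissible allsE; set adm := all _ _.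
have -> : adm.
  by apply/allP => p /L6 p6; rewrite act_compose // free_f // compose_S6.
by move=> /(_ isT) /Z.leb_le; lia.
Qed.

(** There are finitely many patterns, so the score is bounded below; this
    handles the negligible set of tuples that span a bad pattern. *)
Lemma orb_score_lower_bound C : valid_certificate C ->
  exists B : nat, forall f, hypergraph f -> supported f ->
    (- (B%:R : Z) <= orb (local_score C) f)%R.
Proof.
move=> validC; pose F b := Z.abs_nat (total_score C (of_bits b)).
have leF (s : seq (seq bool)) b : b \in s -> (F b <= \sum_(b <- s) F b)%N.
  by move=> bs; rewrite (big_rem _ bs) leq_addr.
exists (\sum_(b <- bit_lists 20) F b)%N => f hyp_f sup_f.
have /leF : to_bits f \in bit_lists 20 by have := mem_bit_lists (to_bits f).
move: (\sum_(b <- _) F b)%N => B.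
rewrite orb_score // -{2}(to_bitsK hyp_f sup_f) {leF}/F.
by move: (total_score _ _) => z; lia.
Qed.

(** * The two certificates *)

(** The nested conditionals stop at the first non-edge. *)
Definition F32_at (T : Type) (e : hyperrel T) (a b c d x : T) : bool :=
  if e a b c then if e a d x then if e b d x then e c d x else false else false
  else false.

(** An induced 3-graph on four vertices with three edges, of apex [d]. *)
Definition K4m_at (T : Type) (e : hyperrel T) (d a b c : T) : bool :=
  if e d a b then if e d a c then if e d b c then ~~ e a b c else false else false
  else false.

Lemma F32_atE (T : Type) (e : hyperrel T) a b c d x :
  F32_at e a b c d x = [&& e a b c, e a d x, e b d x & e c d x].
Proof. by rewrite /F32_at; do ?case: ifP. Qed.

Lemma K4m_atE (T : Type) (e : hyperrel T) d a b c :
  K4m_at e d a b c = [&& e d a b, e d a c, e d b c & ~~ e a b c].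
Proof. by rewrite /K4m_at; do ?case: ifP. Qed.

Definition F32_pattern (f : hyperrel nat) : bool := F32_at f 0 1 2 3 4.
Definition F32_or_K4m_pattern (f : hyperrel nat) : bool :=
  if F32_at f 0 1 2 3 4 then true else K4m_at f 0 1 2 3.

Definition F32_cosets : seq (seq nat) :=
  Eval vm_compute in
  [seq p <- S6 | [&& increasing p 0 1, increasing p 1 2 & increasing p 3 4]].

Definition K4m_cosets : seq (seq nat) :=
  Eval vm_compute in
  [seq p <- S6 | [&& increasing p 1 2, increasing p 2 3 & increasing p 4 5]].

(** The coefficients were obtained by rounding the solution of a semidefinite
    program. For all roots, each form has mean zero in the extremal 3-graph A + B
    with |B| = n/3, as asymptotic equality in the bound requires. For instance
    18 (d1 + d2) has mean 16 there because every vertex has degree density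
    4/9. *)
Definition F32_certificate : certificate := {|
  target := 256; scale := 576;
  pair_squares := [::
    (1, fun s t d1 d2 =>
       18 * (d1 + d2) - 16 - 5 * (s + t) * (d1 + d2)
       + 10 * (s + t) * d1 * d2 + 15 * s * t * (d1 + d2));
    (60, fun s t d1 d2 => (d1 - d2) * (3 - 2 * (s + t - s * t)));
    (163, fun s t d1 d2 => (d1 - d2) * (s + t - s * t))];
  quad_root := fun x y _ _ => x && y;
  quad_squares := [::
    (68, fun x01 x02 x03 x12 x13 x23 =>
       4 * x23 - 2 * x01 + x02 + x03 + x12 + x13 - 2);
    (291, fun _ x02 x03 x12 x13 _ => x02 - x03 + x12 - x13);
    (392, fun _ x02 x03 x12 x13 _ => x02 - x03 - x12 + x13)] |}%BinZ.

(** Again every form has mean zero, for all roots, in the complete balanced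
    4-partite 3-graph; here all vertices have degree density 3/8. *)
Definition K4m_certificate : certificate := {|
  target := 5400; scale := 14400;
  pair_squares := [::
    (600, fun _ _ d1 d2 => 4 * (d1 + d2) - 3);
    (5760, fun _ _ d1 d2 => d1 - d2)];
  quad_root := fun x y z w => [&& x, y, ~~ z & ~~ w];
  quad_squares := [::
    (176, fun x01 x02 x03 x12 x13 _ =>
       12 * (x02 * x12 + x03 * x13) + 18 * (x02 * x13 + x03 * x12) + 2 * x01
       - 7 * (x02 + x03 + x12 + x13) - 2 * (x02 * x03 + x12 * x13));
    (2112, fun x01 x02 x03 x12 x13 _ =>
       3 * (x02 * x13 + x03 * x12) - 3 * (x02 * x12 + x03 * x13)
       + (x02 * x03 + x12 * x13) - 2 * x01);
    (133, fun x01 x02 x03 x12 x13 _ =>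
       3 * (x02 + x03 + x12 + x13) + 2 * (x02 * x03 + x12 * x13) - 16 * x01);
    (16560, fun _ x02 x03 x12 x13 _ => x02 + x03 - x12 - x13);
    (1800, fun _ x02 x03 x12 x13 _ =>
       4 * (x02 - x03 + x12 - x13) - 7 * (x02 * x12 - x03 * x13));
    (46800, fun _ x02 x03 x12 x13 _ => x02 * x12 - x03 * x13);
    (68400, fun _ x02 x03 x12 x13 _ => x02 * x13 - x03 * x12)] |}%BinZ.

Lemma F32_certificate_valid : valid_certificate F32_certificate.
Proof.
split; [by [] | by [] | | | by [] | by move=> x y z w; apply: andbC | |] => *;
  cbv [pair_sum quad_sum sumZ pair_squares quad_squares F32_certificate fst snd]; ring.
Qed.

Lemma K4m_certificate_valid : valid_certificate K4m_certificate.
Proof.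
split; [by [] | by [] | | | by do 4 case | by do 4 case | |] => *;
  cbv [pair_sum quad_sum sumZ pair_squares quad_squares K4m_certificate fst snd]; ring.
Qed.

Lemma F32_cosets_sub : {subset F32_cosets <= S6}.
Proof. by apply/allP; vm_compute. Qed.

Lemma F32_K4m_cosets_sub : {subset F32_cosets ++ K4m_cosets <= S6}.
Proof. by apply/allP; vm_compute. Qed.

Lemma F32_certificate_verified : verify F32_pattern F32_cosets F32_certificate.
Proof. by vm_compute. Qed.

Lemma K4m_certificate_verified :
  verify F32_or_K4m_pattern (F32_cosets ++ K4m_cosets) K4m_certificate.
Proof. by vm_compute. Qed.

(** * From patterns to 3-graphs *)

Local Open Scope ring_scope.

Lemma sum_squares_ge0 (W : finType) (G : Type) (s : seq (Z * G)) (F : G -> W -> Z) :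
  all (fun g => Z.leb 0 g.1) s ->
  0 <= \sum_(y : W) \sum_(z : W) sumZ (fun g => g.1 * (F g.2 y * F g.2 z))%BinZ s.
Proof.
move=> w_ge0.
have -> : \sum_(y : W) \sum_(z : W) sumZ (fun g => g.1 * (F g.2 y * F g.2 z))%BinZ s
    = \sum_(g <- s) g.1 * ((\sum_y F g.2 y) * (\sum_z F g.2 z)).
  under eq_bigr do under eq_bigr do rewrite sumZE.
  under eq_bigr do rewrite exchange_big.
  rewrite exchange_big; apply: eq_bigr => g _.
  by rewrite big_distrlr mulr_sumr; apply: eq_bigr => y _; rewrite mulr_sumr.
elim: s w_ge0 => [|g s IHs] /=; first by rewrite big_nil.
case/andP=> g_ge0 /IHs s_ge0; rewrite big_cons addr_ge0 //.
by apply: mulr_ge0; [exact: g_ge0 | rewrite -expr2 sqr_ge0].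
Qed.

Lemma ler_sum_mem (T : eqType) (F : T -> Z) (s : seq T) t :
  (forall t, 0 <= F t) -> t \in s -> F t <= \sum_(t <- s) F t.
Proof. by move=> F_ge0 ts; rewrite (big_rem _ ts) lerDl sumr_ge0. Qed.

Section Averaging.
Variables (V : finType) (e : hyperrel V) (hyper_e : hypergraph e).
Implicit Types (x : {ffun 'I_6 -> V}) (p : seq nat) (C : certificate).

Definition pattern (x : {ffun 'I_6 -> V}) : hyperrel nat := fun i j k =>
  if [&& (i < 6)%N, (j < 6)%N & (k < 6)%N] then
    e (x (inord i)) (x (inord j)) (x (inord k))
  else false.

Lemma pattern_hypergraph x : hypergraph (pattern x).
Proof.
have [e12 e23 e11] := hyper_e; rewrite /pattern.
split=> [i j k|i j k|i j]; last by rewrite e11 if_same.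
  by rewrite andbCA e12.
by rewrite [X in _ && X]andbC e23.
Qed.

Lemma pattern_supported x : supported (pattern x).
Proof. by move=> i j k; rewrite /pattern; case: ifP. Qed.

Definition relabel (p : seq nat) (x : {ffun 'I_6 -> V}) : {ffun 'I_6 -> V} :=
  [ffun i : 'I_6 => x (inord (nth 6%N p i))].

Lemma act_pattern p x : p \in S6 -> act p (pattern x) = pattern (relabel p x).
Proof.
move=> p6; apply/funext=> i; apply/funext=> j; apply/funext=> k.
rewrite /act /pattern !nth_S6_lt //; case: ifP => // /and3P[i6 j6 k6].
by rewrite !ffunE !inordK.
Qed.

Lemma relabel_inj p : p \in S6 -> injective (relabel p).
Proof.
move=> p6 x y /ffunP xy; apply/ffunP => i.
have ip : (i : nat) \in p.
  by move: p6; rewrite mem_S6 => /perm_mem ->; rewrite mem_iota ltn_ord.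
have lt6 : (index (i : nat) p < 6)%N by move: ip; rewrite -index_mem size_S6.
have := xy (inord (index (i : nat) p)).
by rewrite !ffunE inordK // nth_index // inord_val.
Qed.

Lemma sum_orb (h : hyperrel nat -> Z) :
  \sum_x orb h (pattern x) = (\sum_x h (pattern x)) *+ 720%N.
Proof.
rewrite /orb exchange_big big_seq.
have size720 : size S6 = 720%N by rewrite size_permutations ?iota_uniq.
rewrite -size720 -iter_addr_0 -count_predT -big_const_seq [RHS]big_seq.
apply: eq_bigr => p p6; rewrite [RHS](reindex_inj (relabel_inj p6)).
by apply: eq_bigr => x _; rewrite act_pattern.
Qed.

(** Only the first two terms of the score survive: the sum of each weighted
    product over its two independent extensions is a weighted square. *)
Lemma sum_local_score C : valid_certificate C ->
  \sum_x local_score C (pattern x) <=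
    target C *+ (#|V| ^ 6)%N
    - scale C * (\sum_a \sum_b \sum_c bitZ (e a b c)) *+ (#|V| ^ 3)%N.
Proof.
move=> validC.
have -> : \sum_x local_score C (pattern x) =
    \sum_(x : {ffun 'I_6 -> V}) (target C
    - scale C * bitZ (e (x (inord 0%N)) (x (inord 1%N)) (x (inord 2%N)))
    - pair_form C e (x (inord 0%N)) (x (inord 1%N)) (x (inord 2%N))
       (x (inord 3%N)) (x (inord 4%N)) (x (inord 5%N))
    - quad_form C e (x (inord 0%N)) (x (inord 1%N)) (x (inord 2%N))
       (x (inord 3%N)) (x (inord 4%N)) (x (inord 5%N))) by [].
rewrite !sumrB sumr_const card_ffun card_ord -mulr_sumr.
rewrite (big_ffun6 (fun a b c _ _ _ => bitZ (e a b c))).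
rewrite (big_ffun6 (pair_form C e)) (big_ffun6 (quad_form C e)).
set P := \sum_(a : V) \sum_b \sum_c \sum_d \sum_u \sum_v pair_form _ _ _ _ _ _ _ _.
set Q := \sum_(a : V) \sum_b \sum_c \sum_d \sum_u \sum_v quad_form _ _ _ _ _ _ _ _.
have P_ge0 : 0 <= P.
  apply: sumr_ge0 => a _; apply: sumr_ge0 => b _.
  pose F (g : Z -> Z -> Z -> Z -> Z) (y : V * V) := g (bitZ (e a b y.1))
    (bitZ (e a b y.2)) (bitZ (e a y.1 y.2)) (bitZ (e b y.1 y.2)).
  rewrite pair_bigA; under eq_bigr do rewrite pair_bigA.
  exact: (@sum_squares_ge0 _ _ _ F (pair_weights_ge0 validC)).
have Q_ge0 : 0 <= Q.
  apply: sumr_ge0 => a _; apply: sumr_ge0 => b _.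
  apply: sumr_ge0 => c _; apply: sumr_ge0 => d _.
  rewrite /quad_form; case: (quad_root _ _ _ _ _); last first.
    by rewrite big1 // => u _; rewrite big1.
  pose F (g : Z -> Z -> Z -> Z -> Z -> Z -> Z) (u : V) :=
    g (bitZ (e a b u)) (bitZ (e a c u)) (bitZ (e a d u))
      (bitZ (e b c u)) (bitZ (e b d u)) (bitZ (e c d u)).
  exact: (@sum_squares_ge0 _ _ _ F (quad_weights_ge0 validC)).
have -> : \sum_a \sum_b \sum_c \sum_(d : V) \sum_(u : V) \sum_(v : V)
      bitZ (e a b c) =
    (\sum_a \sum_b \sum_c bitZ (e a b c)) *+ (#|V| ^ 3)%N.
  do 3 (rewrite -sumrMnl; apply: eq_bigr => ? _).
  by rewrite !sumr_const -!mulrnA !expnS muln1 mulnA.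
rewrite mulrnAr -!addrA lerD2l gerDl -opprD oppr_le0.
exact: addr_ge0.
Qed.

(** The orbit sum of [score + B bad] is nonnegative on every pattern: either no
    relabelling is bad and the verification applies, or [B] compensates for the
    lower bound of the score. *)
Lemma score_count C bad L (B : nat) :
    valid_certificate C -> {subset L <= S6} -> verify bad L C ->
    (forall f, hypergraph f -> supported f -> - (B%:R : Z) <= orb (local_score C) f) ->
  scale C * (\sum_a \sum_b \sum_c bitZ (e a b c)) *+ (#|V| ^ 3)%N <=
    target C *+ (#|V| ^ 6)%N + B%:R * \sum_x bitZ (bad (pattern x)).
Proof.
move=> validC L6 checked boundB.
pose h f := local_score C f + B%:R * bitZ (bad f).
have orb_h x : 0 <= orb h (pattern x).
  rewrite /orb big_split -mulr_sumr /=.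
  have [free|/allPn[p p6 bad_p]] :=
      boolP (all (fun p => ~~ bad (act p (pattern x))) S6).
    apply: addr_ge0.
      apply: (orb_score_ge0 validC L6 checked (pattern_hypergraph x)
        (@pattern_supported x)) => p p6; exact: (allP free).
    by rewrite mulr_ge0 ?sumr_ge0 // => p _; case: (bad _).
  rewrite -lerBlDr sub0r.
  apply: le_trans (boundB _ (pattern_hypergraph x) (@pattern_supported x)).
  rewrite lerN2 ler_peMr ?ler0n //.
  have := @ler_sum_mem _ (fun p => bitZ (bad (act p (pattern x)))) _ _ _ p6.
  by rewrite (negbNE bad_p); apply=> q; case: (bad _).
have : 0 <= (\sum_x h (pattern x)) *+ 720%N by rewrite -sum_orb sumr_ge0.
rewrite pmulrn_lge0 // big_split -mulr_sumr /=.
move=> sum_ge0; have : - (B%:R * \sum_x bitZ (bad (pattern x))) <=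
    \sum_x local_score C (pattern x) by rewrite -subr_ge0 opprK.
by move=> /le_trans/(_ (sum_local_score validC)); rewrite lerBrDl -lerBlDr.
Qed.
End Averaging.

(** * Bounds on the number of ordered hyperedges *)

Arguments F32_at : simpl never.
Arguments K4m_at : simpl never.

Definition ordered_count (V : finType) (e : hyperrel V) : nat :=
  (\sum_a \sum_b \sum_c e a b c)%N.

Lemma bitZ_false b : ~~ b -> bitZ b = 0.
Proof. by case: b. Qed.

Lemma sum_bitZ (I : finType) (P : I -> bool) :
  \sum_i bitZ (P i) = (\sum_i P i)%N%:R.
Proof. by rewrite natr_sum; apply: eq_bigr => i _; case: (P i). Qed.

Lemma ordered_countZ (V : finType) (e : hyperrel V) :
  \sum_a \sum_b \sum_c bitZ (e a b c) = (ordered_count e)%:R.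
Proof.
rewrite natr_sum; apply: eq_bigr => a _; rewrite natr_sum; apply: eq_bigr => b _.
exact: sum_bitZ.
Qed.

Lemma F32_at_pattern (V : finType) (e : hyperrel V) (x : {ffun 'I_6 -> V}) :
  F32_at (pattern e x) 0%N 1%N 2%N 3%N 4%N =
  F32_at e (x (inord 0%N)) (x (inord 1%N)) (x (inord 2%N)) (x (inord 3%N))
    (x (inord 4%N)).
Proof. by []. Qed.

Lemma K4m_at_pattern (V : finType) (e : hyperrel V) (x : {ffun 'I_6 -> V}) :
  K4m_at (pattern e x) 0%N 1%N 2%N 3%N =
  K4m_at e (x (inord 0%N)) (x (inord 1%N)) (x (inord 2%N)) (x (inord 3%N)).
Proof. by []. Qed.

Lemma ordered_count_void (V : finType) (e : hyperrel V) :
  #|V| = 0%N -> ordered_count e = 0%N.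
Proof. by move=> V0; rewrite /ordered_count big1 // => a; have := fintype0 a. Qed.

Lemma F32_free_count (V : finType) (e : hyperrel V) : hypergraph e ->
    (forall a b c d x, ~~ F32_at e a b c d x) ->
  (9 * ordered_count e <= 4 * #|V| ^ 3)%N.
Proof.
move=> hyp_e free_e; have [B boundB] := orb_score_lower_bound F32_certificate_valid.
have := score_count hyp_e F32_certificate_valid F32_cosets_sub
  F32_certificate_verified boundB.
rewrite ordered_countZ big1 ?mulr0 ?addr0 => [|x _]; last first.
  by rewrite /F32_pattern F32_at_pattern (negbTE (free_e _ _ _ _ _)).
rewrite /= => le_Z.
have {le_Z} : (576 * (ordered_count e * #|V| ^ 3) <= 256 * #|V| ^ 6)%N.
  by move: (ordered_count e) (#|V| ^ 3)%N (#|V| ^ 6)%N le_Z => D n3 n6; lia.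
have [/ordered_count_void -> //|n_gt0] := posnP #|V|.
rewrite (expnD _ 3 3) => le_nat.
rewrite -(@leq_pmul2r (64 * #|V| ^ 3)) ?muln_gt0 ?expn_gt0 ?n_gt0 //.
by move: le_nat; move: (ordered_count e) (#|V| ^ 3)%N => D n3; nia.
Qed.

(** The hypothesis on apexes leaves at most n^3 ordered induced copies of K4m,
    hence at most n^5 bad 6-tuples out of n^6. *)
Lemma F32_K4m_count : exists B : nat, forall (V : finType) (e : hyperrel V),
    hypergraph e -> (forall a b c d x, ~~ F32_at e a b c d x) ->
    (forall a a' b c d, K4m_at e a b c d -> K4m_at e a' b c d -> a = a') ->
  (8 * ordered_count e <= 3 * #|V| ^ 3 + B * #|V| ^ 2)%N.
Proof.
have [B boundB] := orb_score_lower_bound K4m_certificate_valid.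
exists B => V e hyp_e free_e apex_e.
have := score_count hyp_e K4m_certificate_valid F32_K4m_cosets_sub
  K4m_certificate_verified boundB.
set num_bad := \sum_x bitZ _ => le_Z.
have bad_le : num_bad <= (#|V| ^ 5)%N%:R.
  have -> : num_bad = \sum_(x : {ffun 'I_6 -> V}) bitZ (K4m_at e (x (inord 0%N))
      (x (inord 1%N)) (x (inord 2%N)) (x (inord 3%N))).
    apply: eq_bigr => x _.
    rewrite /F32_or_K4m_pattern F32_at_pattern K4m_at_pattern.
    by rewrite (negbTE (free_e _ _ _ _ _)).
  rewrite (big_ffun6 (fun a b c d _ _ => bitZ (K4m_at e a b c d))).
  rewrite exchange_big; under eq_bigr do rewrite exchange_big.
  under eq_bigr do under eq_bigr do rewrite exchange_big.
  have -> : (#|V| ^ 5)%N%:R = \sum_(b : V) \sum_(c : V) \sum_(d : V)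
      ((#|V| ^ 2)%N%:R : Z).
    by rewrite !sumr_const -!mulrnA !expnS muln1 !mulnA.
  apply: ler_sum => b _; apply: ler_sum => c _; apply: ler_sum => d _.
  have -> : \sum_a \sum_(u : V) \sum_(v : V) bitZ (K4m_at e a b c d) =
      (\sum_a bitZ (K4m_at e a b c d)) *+ (#|V| ^ 2)%N.
    rewrite -sumrMnl; apply: eq_bigr => a _.
    by rewrite !sumr_const -mulrnA !expnS muln1.
  apply: ler_wMn2r.
  have [/existsP[a0 apex_a0]|/existsPn no_apex] :=
      boolP [exists a, K4m_at e a b c d].
    rewrite (bigD1 a0) //= apex_a0 big1 ?addr0 // => a /negbTE neq_a.
    apply: bitZ_false; apply/negP => apex_a.
    by rewrite (apex_e _ _ _ _ _ apex_a apex_a0) eqxx in neq_a.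
  by rewrite big1 // => a _; apply: bitZ_false.
have {le_Z bad_le} : (8 * (ordered_count e * #|V| ^ 3) <=
    3 * #|V| ^ 6 + B * #|V| ^ 5)%N.
  move: le_Z bad_le; rewrite ordered_countZ /=; clearbody num_bad.
  move: (ordered_count e) (#|V| ^ 3)%N (#|V| ^ 6)%N (#|V| ^ 5)%N => D n3 n6 n5.
  nia.
have [/ordered_count_void -> //|n_gt0] := posnP #|V|.
rewrite (expnD _ 3 3) (expnD _ 2 3) => le_nat.
rewrite -(@leq_pmul2r (#|V| ^ 3)) ?expn_gt0 ?n_gt0 //.
by move: le_nat; move: (ordered_count e) (#|V| ^ 3)%N (#|V| ^ 2)%N => D n3 n2; nia.
Qed.

(** * Adjacency relations of 3-graphs *)

Definition adj (T : finType) (H : tgraph T) : hyperrel T :=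
  fun x y z => [set x; y; z] \in edges H.

Lemma cards3 (T : finType) (x y z : T) :
  (#|[set x; y; z]| == 3%N) = [&& x != y, x != z & y != z].
Proof.
rewrite -finset.setUA cardsU1 cards2 !inE negb_or.
by case: (x == y); case: (x == z); case: (y == z).
Qed.

Lemma adj_distinct (T : finType) (H : tgraph T) x y z :
  adj H x y z -> [&& x != y, x != z & y != z].
Proof.
by move=> /(fintype.subsetP (edges_triples H)); rewrite inE cards3.
Qed.

Lemma adj_hypergraph (T : finType) (H : tgraph T) : hypergraph (adj H).
Proof.
split=> [x y z|x y z|x y]; rewrite /adj.
- by rewrite (finset.setUC [set x]).
- by rewrite finset.setUAC.
- by apply/negP => /adj_distinct; rewrite eqxx.
Qed.

Lemma ordered_triples (T : finType) (s : {set T}) : #|s| = 3%N ->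
  (\sum_x \sum_y \sum_z ([set x; y; z] == s) = 6)%N.
Proof.
move=> s3; have eq_s x y z : ([set x; y; z] == s) =
    [&& x \in s, y \in s :\ x & z \in s :\ x :\ y].
  apply/eqP/and3P => [sE|[xs]].
    move: s3 => /eqP; rewrite -sE cards3 !inE => /and3P[xy xz yz].
    by rewrite !eqxx !orbT (eq_sym y) xy !(eq_sym z) xz yz.
  rewrite !inE => /andP[yx ys] /and3P[zy zx zs].
  apply/eqP; rewrite eqEcard s3 (eqP (_ : #|_| == 3%N)); last first.
    by rewrite cards3 !(eq_sym x) yx zx eq_sym zy.
  rewrite leqnn andbT; apply/fintype.subsetP => u.
  by rewrite !inE => /orP[/orP[]|] /eqP ->.
have -> : (6 = \sum_(x in s) \sum_(y in s :\ x) #|s :\ x :\ y|)%N.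
  rewrite (eq_bigr (fun=> 2%N)) ?sum_nat_const ?s3 // => x xs.
  have sx : #|s :\ x| = 2%N by move: (cardsD1 x s); rewrite xs s3 => -[].
  rewrite (eq_bigr (fun=> 1%N)) ?sum_nat_const ?sx // => y ys.
  by move: (cardsD1 y (s :\ x)); rewrite ys sx => -[].
rewrite [RHS]big_mkcond; apply: eq_bigr => x _.
under eq_bigr do under eq_bigr do rewrite eq_s.
case: (x \in s); last by rewrite big1 // => y _; rewrite big1.
rewrite [RHS]big_mkcond; apply: eq_bigr => y _ /=.
case: (y \in s :\ x); last by rewrite big1.
by rewrite -sum1_card [RHS]big_mkcond.
Qed.

Lemma ordered_count_adj (T : finType) (H : tgraph T) :
  ordered_count (adj H) = (6 * #|edges H|)%N.
Proof.
transitivity (\sum_(s in edges H) \sum_x \sum_y \sum_z ([set x; y; z] == s))%N.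
  rewrite [RHS]exchange_big; apply: eq_bigr => x _.
  rewrite [RHS]exchange_big; apply: eq_bigr => y _.
  rewrite [RHS]exchange_big; apply: eq_bigr => z _.
  rewrite /adj; have [xyzH|xyzH] := boolP (_ \in _).
    rewrite (bigD1 _ xyzH) eqxx big1 // => s /andP[_].
    by rewrite eq_sym => /negbTE ->.
  by rewrite big1 // => s sH; apply/eqP; rewrite eqb0; apply: contra xyzH => /eqP ->.
transitivity (\sum_(s in edges H) 6)%N; last by rewrite sum_nat_const mulnC.
apply: eq_bigr => s.
by move=> /(fintype.subsetP (edges_triples H)); rewrite inE => /eqP/ordered_triples.
Qed.

Definition hyperedges (T : finType) (e : hyperrel T) : {set {set T}} :=
  [set [set t.1.1; t.1.2; t.2] | t : T * T * T & e t.1.1 t.1.2 t.2].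

Lemma hypergraph_perm (T : Type) (e : hyperrel T) : hypergraph e ->
  forall x y z, [/\ e x y z = e y x z, e x y z = e x z y, e x y z = e z y x,
      e x y z = e y z x & e x y z = e z x y].
Proof.
move=> [e12 e23 _] x y z.
split; first [exact: e12 | exact: e23 | by rewrite e12 e23
  | by rewrite e23 e12 | by rewrite e12 e23 e12].
Qed.

Lemma hypergraph_distinct (T : eqType) (e : hyperrel T) : hypergraph e ->
  forall x y z, e x y z -> [&& x != y, x != z & y != z].
Proof.
move=> hyp_e; have [e12 e23 e11] := hyp_e => x y z exyz.
by apply/and3P; split; apply: contraTN exyz => /eqP ->;
  rewrite ?e11 // ?(e23 _ z z) ?(e12 _ z z) 1?e23 ?e11 // e12 e23 e11.
Qed.

Lemma hyperedges_triples (T : finType) (e : hyperrel T) :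
  hypergraph e -> hyperedges e \subset triples T.
Proof.
move=> hyp_e; apply/fintype.subsetP => s /imsetP[[[x y] z]].
rewrite inE /= => exyz ->; by rewrite inE cards3 (hypergraph_distinct hyp_e exyz).
Qed.

Definition tgraph_of (T : finType) (e : hyperrel T) (hyp_e : hypergraph e) :
  tgraph T := TGraph (hyperedges_triples hyp_e).

Lemma adj_tgraph_of (T : finType) (e : hyperrel T) (hyp_e : hypergraph e) :
  adj (tgraph_of hyp_e) = e.
Proof.
apply/funext=> x; apply/funext=> y; apply/funext=> z; apply/idP/idP => [|exyz]; last first.
  by apply/imsetP; exists (x, y, z); rewrite ?inE.
move=> /[dup] /adj_distinct /and3P[xy xz yz] /imsetP[[[a b] c]].
  rewrite inE /= => eabc xyzE.
  have [s12 s23 s13 s231 s312] := hypergraph_perm hyp_e a b c.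
  have mem u : u \in [set x; y; z] -> [|| u == a, u == b | u == c].
    by rewrite xyzE !inE -orbA.
  have /or3P[] : [|| x == a, x == b | x == c] by rewrite mem ?inE ?eqxx.
  all: move=> /eqP xE; have /or3P[] : [|| y == a, y == b | y == c]
    by rewrite mem ?inE ?eqxx ?orbT.
  all: move=> /eqP yE; have /or3P[] : [|| z == a, z == b | z == c]
    by rewrite mem ?inE ?eqxx ?orbT.
  all: move=> /eqP zE; move: xy xz yz; rewrite xE yE zE ?eqxx //.
  - by rewrite -s23.
  - by rewrite -s12.
  - by rewrite -s231.
  - by rewrite -s312.
  - by rewrite -s13.
Qed.

(** * Copies of F32 *)

Lemma imset_triple5 (T : finType) (f : 'I_5 -> T) (i j k : nat) :
  f @: triple5 i j k = [set f (inord i); f (inord j); f (inord k)].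
Proof. by rewrite /triple5 !finset.imsetU !imset_set1. Qed.

Lemma F32_edgesP (s : {set 'I_5}) :
  reflect (exists2 t, t \in [:: (0, 1, 2); (0, 3, 4); (1, 3, 4); (2, 3, 4)]%N &
             s = triple5 t.1.1 t.1.2 t.2) (s \in F32_edges).
Proof.
rewrite !inE -!orbA; apply: (iffP or4P) => [[]/eqP ->|[t]].
- by exists (0, 1, 2)%N.
- by exists (0, 3, 4)%N.
- by exists (1, 3, 4)%N.
- by exists (2, 3, 4)%N.
rewrite !inE => /or4P[]/eqP -> ->; rewrite eqxx.
- by apply: Or41.
- by apply: Or42.
- by apply: Or43.
- by apply: Or44.
Qed.

Definition vertex5 (T : Type) (a b c d x : T) (i : 'I_5) : T :=
  nth a [:: a; b; c; d; x] i.

Lemma vertex5_inj (T : finType) (a b c d x : T) :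
  uniq [:: a; b; c; d; x] -> injective (vertex5 a b c d x).
Proof.
by move=> u i j /eqP; rewrite nth_uniq // => /eqP/val_inj.
Qed.

Lemma F32_at_uniq (T : finType) (H : tgraph T) a b c d x :
  F32_at (adj H) a b c d x -> uniq [:: a; b; c; d; x].
Proof.
rewrite /F32_at; case: ifP => // /adj_distinct /and3P[ab ac bc].
case: ifP => // /adj_distinct /and3P[ad ax dx].
case: ifP => // /adj_distinct /and3P[bd bx _] /adj_distinct /and3P[cd cx _].
by rewrite /= !inE !negb_or ab ac ad ax bc bd bx cd cx dx.
Qed.

Lemma contains_F32 (T : finType) (H : tgraph T) a b c d x :
  F32_at (adj H) a b c d x -> contains F32 H.
Proof.
move=> F32abcdx; apply/existsP; exists [ffun i => vertex5 a b c d x i].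
apply/andP; split.
  apply/injectiveP => i j; rewrite !ffunE.
  exact/vertex5_inj/F32_at_uniq/F32abcdx.
have /and4P[e1 e2 e3 e4] : [&& adj H a b c, adj H a d x, adj H b d x & adj H c d x].
  by move: F32abcdx; rewrite /F32_at; do 3 case: (adj H _ _ _).
apply/fintype.subsetP => _ /imsetP[_ /F32_edgesP[t tF ->] ->].
rewrite imset_triple5 !ffunE /vertex5; move: tF; rewrite !inE.
by case/or4P => /eqP ->; rewrite !inordK.
Qed.

Lemma F32_embedding (T : finType) (H : tgraph T) : contains F32 H ->
  exists a b c d x, F32_at (adj H) a b c d x.
Proof.
case/existsP=> f /andP[_ /fintype.subsetP sub].
exists (f (inord 0%N)), (f (inord 1%N)), (f (inord 2%N)), (f (inord 3%N)),
  (f (inord 4%N)).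
have edge i j k : (i, j, k) \in [:: (0, 1, 2); (0, 3, 4); (1, 3, 4); (2, 3, 4)]%N ->
    adj H (f (inord i)) (f (inord j)) (f (inord k)).
  move=> tF; apply: sub; rewrite -imset_triple5; apply: imset_f.
  by apply/F32_edgesP; exists (i, j, k).
by rewrite /F32_at !edge.
Qed.

Lemma mem_triple5 (i j k m : nat) : (i < 5)%N -> (j < 5)%N -> (k < 5)%N -> (m < 5)%N ->
  (inord m \in triple5 i j k) = (m \in [:: i; j; k]).
Proof. by move=> i5 j5 k5 m5; rewrite !inE -!val_eqE /= !inordK // orbA. Qed.

Lemma triple5_inj (i j k i' j' k' : nat) :
    (i < j < k)%N -> (k < 5)%N -> (i' < j' < k')%N -> (k' < 5)%N ->
  triple5 i j k = triple5 i' j' k' -> (i, j, k) = (i', j', k').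
Proof.
move=> ijk k5 ijk' k5' eq_t.
have bounds p q r : (p < q < r)%N -> (r < 5)%N -> [/\ p < 5, q < 5 & r < 5]%N.
  by move=> /andP[? ?] ?; split; lia.
have [i5 j5 _] := bounds _ _ _ ijk k5; have [i5' j5' _] := bounds _ _ _ ijk' k5'.
suff [-> -> ->] : [:: i; j; k] = [:: i'; j'; k'] by [].
apply: (irr_sorted_eq ltn_trans ltnn); rewrite /= ?andbT // => m.
have [m5|m5] := ltnP m 5; first by rewrite -!mem_triple5 // eq_t.
by rewrite !inE; apply/idP/idP => /or3P[]/eqP; lia.
Qed.

Lemma triples5P (t : {set 'I_5}) : #|t| = 3%N ->
  exists i j k, [/\ (i < j < k)%N, (k < 5)%N & t = triple5 i j k].
Proof.
move=> t3; have := cardE t; rewrite t3.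
have : sorted ltn (map val (enum t)).
  have: subseq (map val (enum t)) (map val (enum 'I_5)).
    by apply: map_subseq; rewrite {1}/enum_mem -enumT; exact: filter_subseq.
  move/(subseq_sorted ltn_trans); apply.
  by rewrite val_enum_ord iota_ltn_sorted.
have := set_enum t; case: (enum t) => [|x [|y [|z [|]]]] //= tE xyz _.
exists x, y, z; split=> //; first by rewrite andbT in xyz.
by rewrite -tE /triple5 !inord_val; apply/finset.setP => u; rewrite !inE orbA.
Qed.

Lemma F32_edgesE (i j k : nat) : (i < j < k)%N -> (k < 5)%N ->
  (triple5 i j k \in F32_edges) =
    ((i, j, k) \in [:: (0, 1, 2); (0, 3, 4); (1, 3, 4); (2, 3, 4)]%N).
Proof.
move=> ijk k5; apply/F32_edgesP/idP => [[[[i' j'] k'] tF /= eq_t]|tF].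
  have [ijk' k5'] : (i' < j' < k')%N /\ (k' < 5)%N.
    by move: tF; rewrite !inE => /or4P[]/eqP[-> -> ->].
  by rewrite (triple5_inj ijk k5 ijk' k5' eq_t).
by exists (i, j, k).
Qed.

(** * Induced copies of the complement of F32 *)

(* Closes [e x y z] from a hypothesis with permuted arguments. *)
Ltac permuted swap :=
  match goal with |- is_true (_ ?x ?y ?z) =>
    case: (swap x y z) => ? ? ? ? ?; unfold is_true in *; congruence end.

(** If a, b, c is the base of two copies of K4m with apexes d and d', none of
    a, b, c can form an edge with d and d': if add' were an edge, the pair ad
    would be joined to b, c and d', which form an edge with apex d', and this
    is a copy of F32; b and c are similar. So the edges on these five vertices are exactly the six
    edges of the two copies. *)
Lemma contains_induced_coF32 (T : finType) (H : tgraph T) (a b c d d' : T) :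
    ~~ contains F32 H -> K4m_at (adj H) d a b c -> K4m_at (adj H) d' a b c ->
    d != d' ->
  contains_induced (compl_tgraph F32) H.
Proof.
move=> free_H apex_d apex_d' neq_d.
have K4mP x : K4m_at (adj H) x a b c ->
    [/\ adj H x a b, adj H x a c, adj H x b c & ~~ adj H a b c].
  by rewrite K4m_atE => /and4P[].
have [dab dac dbc abc] := K4mP _ apex_d; have [dab' dac' dbc' _] := K4mP _ apex_d'.
have free x y z p q : adj H x y z -> adj H x p q -> adj H y p q -> ~~ adj H z p q.
  move=> xyz xpq ypq; apply: contra free_H => zpq.
  by apply: (@contains_F32 _ _ x y z p q); rewrite F32_atE xyz xpq ypq.
have swap := hypergraph_perm (adj_hypergraph H).
have nonedge x y z : adj H d x y -> adj H d x z -> adj H d' y z ->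
    ~~ adj H x d d'.
  move=> dxy dxz dyz'; have [_ _ _ _ ->] := swap x d d'.
  by apply: (@free y z); permuted swap.
have add' := nonedge _ _ _ dab dac dbc'.
have bdd' : ~~ adj H b d d' by apply: (@nonedge b a c) => //; permuted swap.
have cdd' : ~~ adj H c d d' by apply: (@nonedge c a b) => //; permuted swap.
set f := [ffun i => vertex5 a b c d d' i].
have uniq_f : uniq [:: a; b; c; d; d'].
  have /and3P[da db ab] := adj_distinct dab; have /and3P[_ dc ac] := adj_distinct dac.
  have /and3P[_ _ bc] := adj_distinct dbc; have /and3P[d'a d'b _] := adj_distinct dab'.
  have /and3P[_ d'c _] := adj_distinct dac'.
  by rewrite /= !inE !negb_or ab ac (eq_sym a d) da (eq_sym a d') d'a bc
    (eq_sym b d) db (eq_sym b d') d'b (eq_sym c d) dc (eq_sym c d') d'c neq_d.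
have f_inj : injective f.
  by move=> i j; rewrite !ffunE; apply: vertex5_inj.
have key (t : {set 'I_5}) : #|t| = 3%N -> (f @: t \in edges H) = (t \notin F32_edges).
  case/triples5P => i [j [k [ijk k5 ->]]]; rewrite F32_edgesE //.
  rewrite imset_triple5 !ffunE /vertex5 -[LHS]/(adj H _ _ _).
  have /andP[ij jk] := ijk; have j5 := ltn_trans jk k5.
  have i5 := ltn_trans ij j5; move=> {ij jk}.
  rewrite !inordK //.
  case: i ijk i5 => [|[|[|[|[|//]]]]]; case: j j5 => [|[|[|[|[|//]]]]];
    case: k k5 => [|[|[|[|[|//]]]]] //= _ _ _ _;
    rewrite ?(negbTE abc) ?(negbTE add') ?(negbTE bdd') ?(negbTE cdd') //;
    apply/idP; permuted swap.
apply/existsP; exists (f @: [set: 'I_5]); apply/existsP; exists f.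
apply/and3P; split=> //; first exact/injectiveP.
apply/eqP/finset.setP => s; apply/imsetP/idP => [[t] | ].
  rewrite finset.in_setD => /andP[tF]; rewrite finset.in_set => /eqP t3 ->.
  rewrite finset.in_set key // tF /=.
  by rewrite (finset.imsetS f (finset.subsetT t)).
rewrite finset.in_set => /andP[sH s_sub].
have s3 : #|s| = 3%N.
  by have /(fintype.subsetP (edges_triples H)) := sH; rewrite inE => /eqP.
have sE : f @: (f @^-1: s) = s.
  apply/finset.setP => x; apply/imsetP/idP => [[i]|xs]; first by rewrite inE => ? ->.
  have /imsetP[i _ xE] := fintype.subsetP s_sub _ xs.
  by exists i; rewrite // inE -xE.
have t3 : #|f @^-1: s| = 3%N by rewrite -(card_imset _ f_inj) sE.
exists (f @^-1: s); last by rewrite sE.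
apply/finset.setDP; split; last by rewrite -key // sE.
by rewrite finset.in_set; apply/eqP.
Qed.

(** * Extremal constructions *)

Lemma sum_below n m : (m <= n)%N -> (\sum_(x < n) (x < m) = m)%N.
Proof.
suff -> : (\sum_(x < n) (x < m) = minn m n)%N by move/minn_idPl.
elim: n => [|p IHp]; first by rewrite big_ord0 minn0.
by rewrite big_ord_recr /= IHp; case: (ltnP p m); lia.
Qed.

Lemma sum_residue n k : (k < 4)%N ->
  (\sum_(x < n) (x %% 4 == k) = (n + 3 - k) %/ 4)%N.
Proof.
move=> k4; elim: n => [|p IHp]; first by rewrite big_ord0; lia.
by rewrite big_ord_recr /= IHp; case: eqP; lia.
Qed.

Section Constructions.
Variable n : nat.

Definition two_plus_one (m : nat) : hyperrel 'I_n := fun x y z =>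
  [&& x != y, x != z, y != z & ((x < m) + (y < m) + (z < m) == 1)%N].

Definition four_partite : hyperrel 'I_n := fun x y z =>
  [&& x %% 4 != y %% 4, x %% 4 != z %% 4 & y %% 4 != z %% 4]%N.

Lemma two_plus_one_hypergraph m : hypergraph (two_plus_one m).
Proof.
split=> [x y z|x y z|x y]; rewrite /two_plus_one ?eqxx //.
  rewrite (eq_sym y x) (addnC (x < m)%N).
  by case: (x == y); case: (x == z); case: (y == z).
rewrite (eq_sym z y) addnAC.
by case: (x == y); case: (x == z); case: (y == z).
Qed.

Lemma four_partite_hypergraph : hypergraph four_partite.
Proof.
split=> [x y z|x y z|x y]; rewrite /four_partite ?eqxx //.
  rewrite (eq_sym (y %% 4)%N (x %% 4)%N).
  by case: (_ != _); case: (_ != _); case: (_ != _).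
rewrite (eq_sym (z %% 4)%N (y %% 4)%N).
by case: (_ != _); case: (_ != _); case: (_ != _).
Qed.

Lemma two_plus_one_F32_free m a b c d x : ~~ F32_at (two_plus_one m) a b c d x.
Proof.
apply/negP; rewrite /F32_at /two_plus_one.
case: ifP => // /and4P[_ _ _ abc]; case: ifP => // /and4P[_ _ _ adx].
case: ifP => // /and4P[_ _ _ bdx] /and4P[_ _ _ cdx].
by move: abc adx bdx cdx; case: (a < m)%N; case: (b < m)%N; case: (c < m)%N;
  case: (d < m)%N; case: (x < m)%N.
Qed.

(** The three vertices of the edge abc have different colours, and both d and x
    avoid these colours and differ from each other: that needs five colours. *)
Lemma four_partite_F32_free a b c d x : ~~ F32_at four_partite a b c d x.
Proof.
apply/negP; rewrite /F32_at /four_partite.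
case: ifP => // /and3P[ab ac bc]; case: ifP => // /and3P[ad ax dx].
case: ifP => // /and3P[bd bx _] /and3P[cd cx _].
have := ltn_pmod a (isT : 0 < 4)%N; have := ltn_pmod b (isT : 0 < 4)%N.
have := ltn_pmod c (isT : 0 < 4)%N; have := ltn_pmod d (isT : 0 < 4)%N.
have := ltn_pmod x (isT : 0 < 4)%N.
move: (a %% 4)%N (b %% 4)%N (c %% 4)%N (d %% 4)%N (x %% 4)%N ab ac bc ad ax dx bd bx cd cx.
move=> a' b' c' d' x'; lia.
Qed.

Lemma sum_above m : (m <= n)%N -> (\sum_(x < n) ~~ (x < m) = n - m)%N.
Proof.
move=> le_mn; apply/eqP; rewrite -(eqn_add2l m) -{1}(sum_below le_mn) -big_split.
rewrite subnKC // (eq_bigr (fun=> 1%N)) => [|x _]; last by case: (x < m)%N.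
by rewrite sum_nat_const card_ord muln1.
Qed.

Lemma two_plus_one_count m : (m <= n)%N ->
  (ordered_count (two_plus_one m) = 3 * (m * ((n - m) * (n - m).-1)))%N.
Proof.
move=> le_mn.
pose c (x y z : 'I_n) := ((x < m) * (~~ (y < m) * (~~ (z < m) && (z != y))))%N.
have sum_c : (\sum_x \sum_y \sum_z c x y z = m * ((n - m) * (n - m).-1))%N.
  rewrite -{1}(sum_below le_mn) big_distrl; apply: eq_bigr => x _.
  rewrite -{1}(sum_above le_mn) big_distrl big_distrr; apply: eq_bigr => y _ /=.
  rewrite /c; under eq_bigr do rewrite mulnA.
  rewrite -big_distrr /= -mulnA; congr (_ * _)%N.
  case: (boolP (y < m)%N) => [_|ym] //=; rewrite !mul1n.
  have := sum_above le_mn; rewrite (bigD1 y) //= ym => /= <-.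
  rewrite [LHS](bigD1 y) //= eqxx andbF add0n ?add1n /=.
  by apply: eq_bigr => z ->; rewrite andbT.
transitivity (\sum_x \sum_y \sum_z (c x y z + c y x z + c z x y))%N.
  apply: eq_bigr => x _; apply: eq_bigr => y _; apply: eq_bigr => z _.
  rewrite /c /two_plus_one (eq_sym z y) (eq_sym z x) (eq_sym y x).
  have [<-|_] := eqVneq x y; last have [<-|_] := eqVneq x z;
    last have [<-|_] := eqVneq y z; rewrite ?eqxx ?andbF ?muln0 ?addn0 ?add0n;
    by case: (x < m)%N; try case: (y < m)%N; try case: (z < m)%N.
under eq_bigr do under eq_bigr do rewrite !big_split.
under eq_bigr do rewrite !big_split.
rewrite !big_split /= sum_c [X in (_ + X + _)%N]exchange_big sum_c.
under [X in (_ + _ + X)%N]eq_bigr do rewrite exchange_big.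
rewrite [X in (_ + _ + X)%N]exchange_big /= sum_c; lia.
Qed.

Lemma four_partite_count :
  (n * ((n - (n %/ 4 + 1)) * (n - 2 * (n %/ 4 + 1))) <= ordered_count four_partite)%N.
Proof.
set M := (n %/ 4 + 1)%N.
have sizeM (x : 'I_n) : (\sum_(y < n) (x %% 4 == y %% 4) <= M)%N.
  under eq_bigr do rewrite eq_sym.
  by rewrite sum_residue ?ltn_pmod //; have := ltn_pmod x (isT : 0 < 4)%N; lia.
have sum1 : (\sum_(y < n) 1 = n)%N by rewrite sum_nat_const card_ord muln1.
rewrite -{1}sum1 big_distrl; apply: leq_sum => x _ /=; rewrite mul1n.
apply: (@leq_trans (\sum_(y < n) (x %% 4 != y %% 4) * (n - 2 * M))%N).
  rewrite -big_distrl leq_mul2r; apply/orP; right.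
  rewrite leq_subLR (leq_trans _ (leq_add (sizeM x) (leqnn _))) //.
  rewrite -big_split -{1}sum1; apply: leq_sum => y _ /=; by case: eqP.
apply: leq_sum => y _; rewrite /four_partite.
case: (x %% 4 != y %% 4)%N => //=; rewrite mul1n.
have := leq_add (sizeM x) (sizeM y); rewrite leq_subLR mul2n -addnn.
move=> le2; apply: (leq_trans _ (leq_add le2 (leqnn _))).
rewrite -!big_split -{1}sum1; apply: leq_sum => z _ /=.
by case: eqP; case: eqP.
Qed.

End Constructions.

(** In the complement of F32, whose missing triples are 012, 034, 134 and 234,
    the vertices 0, 1, 2 and 3 induce a K4m of apex 3. *)
Lemma coF32_embedding (T : finType) (H : tgraph T) :
  contains_induced (compl_tgraph F32) H -> exists a b c d,
    [/\ adj H a b d, adj H a c d, adj H b c d & ~~ adj H a b c].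
Proof.
case/existsP=> S /existsP[f /and3P[/injectiveP f_inj _ /eqP/finset.setP edgesE]].
exists (f (inord 0%N)), (f (inord 1%N)), (f (inord 2%N)), (f (inord 3%N)).
have in_co i j k : (i < j < k)%N -> (k < 5)%N ->
    (triple5 i j k \in edges (compl_tgraph F32)) =
    ((i, j, k) \notin [:: (0, 1, 2); (0, 3, 4); (1, 3, 4); (2, 3, 4)]%N).
  move=> ijk k5; rewrite [LHS]finset.in_setD F32_edgesE //.
  by rewrite finset.in_set card_triple5 // andbT.
have edge i j k : (i < j < k)%N -> (k < 5)%N ->
    (i, j, k) \notin [:: (0, 1, 2); (0, 3, 4); (1, 3, 4); (2, 3, 4)]%N ->
    (f @: triple5 i j k \in edges H) && (f @: triple5 i j k \subset S).
  move=> ijk k5 tF; have := edgesE (f @: triple5 i j k).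
  by rewrite [in RHS]inE => <-; apply: imset_f; rewrite in_co.
have adjE i j k : adj H (f (inord i)) (f (inord j)) (f (inord k)) =
    (f @: triple5 i j k \in edges H) by rewrite imset_triple5.
have /andP[e013 s013] : _ := @edge 0%N 1%N 3%N isT isT isT.
have /andP[e023 s023] : _ := @edge 0%N 2%N 3%N isT isT isT.
have /andP[e123 _] : _ := @edge 1%N 2%N 3%N isT isT isT.
split; rewrite adjE //; apply/negP => e012.
have sub012 : f @: triple5 0 1 2 \subset S.
  rewrite imset_triple5 in s013; rewrite imset_triple5 in s023.
  rewrite imset_triple5; apply/fintype.subsetP => x; rewrite !inE.
  case/orP=> [/orP[]|] /eqP ->; [apply: (fintype.subsetP s013)
    | apply: (fintype.subsetP s013) | apply: (fintype.subsetP s023)];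
    by rewrite !inE eqxx ?orbT.
have := edgesE (f @: triple5 0 1 2); rewrite [in RHS]inE e012 sub012.
case/imsetP=> t tco /(imset_inj f_inj) tE.
by move: tco; rewrite -tE in_co.
Qed.

Lemma four_partite_coF32_free n (hyp : hypergraph (@four_partite n)) :
  ~~ contains_induced (compl_tgraph F32) (tgraph_of hyp).
Proof.
apply/negP => /coF32_embedding[a [b [c [d]]]]; rewrite adj_tgraph_of.
case=> /and3P[ab _ _] /and3P[ac _ _] /and3P[bc _ _].
by rewrite /four_partite ab ac bc.
Qed.

(** * Bounds on the extremal numbers *)

Lemma bigmax_closed (I : finType) (P : pred I) (F : I -> nat) (C : nat -> Prop) :
  C 0%N -> (forall i, P i -> C (F i)) -> C (\max_(i | P i) F i).
Proof.
move=> C0 CF; apply: (big_ind C) => // x y Cx Cy.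
by rewrite /maxn; case: ifP.
Qed.

Lemma ex_F32_upper n : (9 * (6 * ex_turan F32 n) <= 4 * n ^ 3)%N.
Proof.
apply: (@bigmax_closed _ _ _ (fun k => 9 * (6 * k) <= 4 * n ^ 3)%N).
  by rewrite !muln0.
move=> H free_H.
rewrite -ordered_count_adj -[X in (X ^ 3)%N](card_ord n).
apply: F32_free_count => [|a b c d x]; first exact: adj_hypergraph.
by apply: contra free_H; apply: contains_F32.
Qed.

Lemma ex_F32_lower n m : (m <= n)%N ->
  (3 * (m * ((n - m) * (n - m).-1)) <= 6 * ex_turan F32 n)%N.
Proof.
move=> le_mn; have hyp := two_plus_one_hypergraph n m.
rewrite -two_plus_one_count // -(adj_tgraph_of hyp) ordered_count_adj.
rewrite leq_mul2l /=; apply: (@leq_bigmax_cond _ _ (fun H => #|edges H|) (tgraph_of hyp)).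
apply/negP => /F32_embedding[a [b [c [d [x]]]]].
by rewrite adj_tgraph_of; apply/negP/two_plus_one_F32_free.
Qed.

Lemma ex_induced_upper : exists B : nat, forall n,
  (8 * (6 * ex_turan_induced F32 (compl_tgraph F32) n) <= 3 * n ^ 3 + B * n ^ 2)%N.
Proof.
have [B boundB] := F32_K4m_count; exists B => n.
apply: (@bigmax_closed _ _ _
  (fun k => 8 * (6 * k) <= 3 * n ^ 3 + B * n ^ 2)%N); first by rewrite !muln0.
move=> H /andP[free_H ind_H].
rewrite -ordered_count_adj -[X in (X ^ 3)%N](card_ord n) -[X in (X ^ 2)%N](card_ord n).
apply: boundB => [|a b c d x|d d' a b c apex_d apex_d'].
- exact: adj_hypergraph.
- by apply: contra free_H; apply: contains_F32.
- have [//|neq_d] := eqVneq d d'; case/negP: ind_H.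
  exact: contains_induced_coF32 free_H apex_d apex_d' neq_d.
Qed.

Lemma ex_induced_lower n :
  (n * ((n - (n %/ 4 + 1)) * (n - 2 * (n %/ 4 + 1))) <=
    6 * ex_turan_induced F32 (compl_tgraph F32) n)%N.
Proof.
have hyp := four_partite_hypergraph n.
apply: leq_trans (four_partite_count n) _.
rewrite -(adj_tgraph_of hyp) ordered_count_adj leq_mul2l /=.
apply: (@leq_bigmax_cond _ _ (fun H => #|edges H|) (tgraph_of hyp)).
rewrite four_partite_coF32_free andbT.
apply/negP => /F32_embedding[a [b [c [d [x]]]]].
by rewrite adj_tgraph_of; apply/negP/four_partite_F32_free.
Qed.

(** * Limits *)

Lemma bin3 n : ('C(n.+3, 3) * 6 = n.+3 * (n.+2 * n.+1))%N.
Proof. by rewrite -[6%N]/(3`!) bin_ffact !ffactnS ffactn0 muln1. Qed.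

(** Dividing by 6 C(n,3) = n^3 + O(n^2) instead of n^3 changes the quotient by
    O(1/n). *)
Lemma edge_density_cvg (R : realType) (m : nat -> nat) (c K : R) : 0 <= c <= 1 ->
    (forall n, `|6 * (m n)%:R - c * n%:R ^+ 3| <= K * n%:R ^+ 2) ->
  (edge_density R m @ \oo --> c)%classic.
Proof.
move=> /andP[c_ge0 c_le1] bound_m.
have K_ge0 : 0 <= K.
  by have := bound_m 1%N; rewrite !expr1n !mulr1; apply: le_trans.
pose h n : R := 16 * (K + 3) * harmonic n.
have h0 : (h @ \oo --> 0)%classic.
  have : (h @ \oo --> 16 * (K + 3) * 0)%classic.
    by apply: cvgM; [exact: cvg_cst | exact: cvg_harmonic].
  by rewrite mulr0.
have below : ((fun n => c - h n) @ \oo --> c)%classic.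
  have : ((fun n => c - h n) @ \oo --> c - 0)%classic.
    by apply: cvgB => //; exact: cvg_cst.
  by rewrite subr0.
have above : ((fun n => c + h n) @ \oo --> c)%classic.
  have : ((fun n => c + h n) @ \oo --> c + 0)%classic.
    by apply: cvgD => //; exact: cvg_cst.
  by rewrite addr0.
apply: squeeze_cvgr below above.
near=> n; rewrite -ler_distlC distrC.
have n3 : (3 <= n)%N by near: n; exists 3%N.
have N3 : 3 <= n%:R :> R by rewrite ler_nat.
have bin6 : 6 * 'C(n, 3)%:R = n%:R * ((n%:R - 1) * (n%:R - 2)) :> R.
  have -> : n = (n - 3).+3 by rewrite -addn3 subnK.
  by rewrite mulrC -natrM bin3 !natrM -!natr1; congr (_ * (_ * _)); lra.
have bin_gt0 : 0 < 6 * 'C(n, 3)%:R :> R by rewrite mulr_gt0 // ltr0n bin_gt0.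
have -> : edge_density R m n - c =
    (6 * (m n)%:R - c * (6 * 'C(n, 3)%:R)) / (6 * 'C(n, 3)%:R).
  rewrite /edge_density mulrBl mulfK ?gt_eqF //; congr (_ - _).
  by rewrite -mulf_div divff ?mul1r // pnatr_eq0.
rewrite normrM normfV (gtr0_norm bin_gt0) ler_pdivrMr // bin6 /h.
have harmonicE : harmonic n * (n%:R + 1) = 1 :> R.
  by rewrite /harmonic natr1 mulVf // pnatr_eq0.
have harmonic_ge0 : 0 <= harmonic n :> R by rewrite /harmonic invr_ge0 ler0n.
have := bound_m n; move: (harmonic n) harmonicE harmonic_ge0 N3 => t tE t_ge0.
move: (n%:R) tE => N tE N3 /ler_normlP[bound1 bound2].
have poly : N ^+ 2 <= 16 * t * (N * ((N - 1) * (N - 2))).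
  have : 0 <= t * N * (16 * ((N - 1) * (N - 2)) - N * (N + 1)) by nra.
  have : N ^+ 2 * (t * (N + 1)) = N ^+ 2 by rewrite tE mulr1.
  lra.
have : (K + 3) * N ^+ 2 <= (K + 3) * (16 * t * (N * ((N - 1) * (N - 2)))).
  by rewrite ler_wpM2l //; lra.
have quad_ge0 : 0 <= N * (3 * N - 2) by apply: mulr_ge0; lra.
have := mulr_ge0 c_ge0 quad_ge0.
have : 0 <= (1 - c) * (N * (3 * N - 2)) by apply: mulr_ge0 => //; lra.
by move=> c_le c_ge scaled; apply/ler_normlP; split; lra.
Unshelve. all: by end_near.
Qed.

Lemma two_plus_one_asymptotics n :
  (4 * n ^ 3 <= 9 * (3 * (n %/ 3 * ((n - n %/ 3) * (n - n %/ 3).-1))) + 18 * n ^ 2)%N.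
Proof.
have := divn_eq n 3; have := ltn_pmod n (isT : 0 < 3)%N.
move: (n %/ 3)%N (n %% 3)%N => q r r3 ->.
have -> : (q * 3 + r - q = q * 2 + r)%N by lia.
rewrite !expnS !expn0 !muln1.
case: q => [|p]; first by case: r r3 => [|[|[|]]].
have -> : ((p.+1 * 2 + r).-1 = p * 2 + r + 1)%N by lia.
by case: r r3 => [|[|[|//]]] _; nia.
Qed.

Lemma four_partite_asymptotics n :
  (3 * n ^ 3 <=
    8 * (n * ((n - (n %/ 4 + 1)) * (n - 2 * (n %/ 4 + 1)))) + 24 * n ^ 2)%N.
Proof.
have := divn_eq n 4; have := ltn_pmod n (isT : 0 < 4)%N.
move: (n %/ 4)%N (n %% 4)%N => q r r4 ->.
rewrite !expnS !expn0 !muln1.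
case: q => [|p]; first by case: r r4 => [|[|[|[|]]]].
have -> : (p.+1 * 4 + r - (p.+1 + 1) = p * 3 + 2 + r)%N by lia.
have -> : (p.+1 * 4 + r - 2 * (p.+1 + 1) = p * 2 + r)%N by lia.
by case: r r4 => [|[|[|[|//]]]] _; nia.
Qed.

Theorem theorem5p3 (R : realType) :
  [/\ cvgn (edge_density R (ex_turan_induced F32 (compl_tgraph F32))),
      cvgn (edge_density R (ex_turan F32)),
      turan_density_induced R F32 (compl_tgraph F32) = 3 / 8,
      (3 / 8 : R) < 4 / 9
    & 4 / 9 = turan_density R F32].
Proof.
have free_cvg : (edge_density R (ex_turan F32) @ \oo --> (4 / 9 : R))%classic.
  apply: (@edge_density_cvg _ _ _ 2) => [|n]; first by lra.
  have := ex_F32_upper n; have lower := ex_F32_lower (leq_div n 3).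
  have := leq_trans (two_plus_one_asymptotics n)
    (leq_add (leq_mul (leqnn 9) lower) (leqnn _)).
  rewrite -!(ler_nat R) !natrD !natrM ?natrX => ? ?.
  by apply/ler_normlP; split; lra.
have induced_cvg : (edge_density R
    (ex_turan_induced F32 (compl_tgraph F32)) @ \oo --> (3 / 8 : R))%classic.
  have [B upper] := ex_induced_upper.
  apply: (@edge_density_cvg _ _ _ (B%:R + 3)) => [|n]; first by lra.
  have := upper n; have lower := ex_induced_lower n.
  have := leq_trans (four_partite_asymptotics n)
    (leq_add (leq_mul (leqnn 8) lower) (leqnn _)).
  rewrite -!(ler_nat R) !natrD !natrM ?natrX.
  have : 0 <= B%:R * n%:R ^+ 2 :> R by rewrite mulr_ge0 ?exprn_ge0.
  have : 0 <= n%:R ^+ 2 :> R by rewrite exprn_ge0.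
  by move=> ? ? ? ?; apply/ler_normlP; split; lra.
have lt_R : (3 / 8 : R) < 4 / 9 by lra.
split=> //; [exact: cvgP induced_cvg | exact: cvgP free_cvg
  | exact: cvg_lim induced_cvg | apply/esym; exact: cvg_lim free_cvg].
Qed.
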